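(* Up to isometric transformations of $(\mathbb{H}^1,d_{cc})$, the persistent H-minimal graphs $S$ fall into two categories: (1) $S$ is given by $(x,y,u(x,y))$ where $$u(x,y)=\frac{m}{1+m^2}(x-x_0)^2+\frac{m^2-1}{m^2+1}(x-x_0)(y-y_0)-\frac{m}{1+m^2}(y-y_0)^2+\frac{a}{\sqrt{1+m^2}}(x-x_0)+\frac{am}{\sqrt{1+m^2}}(y-y_0)+b$$ for $m,a,b,x_0,y_0\in\mathbb{R}$; (2) $S$ is given in cylindrical coordinates by $(\rho\cos\theta,\rho\sin\theta,a\theta+b)$ for $a,b\in\mathbb{R}$.
   Context: The Heisenberg group $\mathbb{H}^1$ is $\mathbb{R}^3$ with coordinates $(x,y,t)$ and left-invariant vector fields $X_1=\partial_x-\frac y2\partial_t$, $X_2=\partial_y+\frac x2\partial_t$, $T=\partial_t$, for the group law $(a,b,c)(\alpha,\beta,\gamma)=(a+\alpha,b+\beta,c+\gamma+\frac12(a\beta-\alpha b))$. $d_{cc}$ is the Carnot–Carathéodory distance: the infimum of lengths (with $X_1,X_2$ orthonormal) of absolutely continuous paths joining two points and tangent to $\mathrm{span}\{X_1,X_2\}$ wherever the derivative exists. For $\lambda\in[1,\infty)$, $g_\lambda$ is the left-invariant Riemannian metric on $\mathbb{H}^1$ for which $\{X_1,X_2,\lambda^{-1}T\}$ is orthonormal. For a graph $t=u(x,y)$ over a domain $\Omega\subset\mathbb{R}^2$ let $p=X_1(t-u)$, $q=X_2(t-u)$ and $(\bar p,\bar q)=(p,q)/\sqrt{p^2+q^2}$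 at points where $(p,q)\ne(0,0)$. The graph is H-minimal if $\int_\Omega\bar p\,\phi_x+\bar q\,\phi_y\,dx\,dy=0$ for all $\phi\in C_0^\infty(\Omega)$. A $C^2$ graph $t=u(x,y)$ is called a persistent H-minimal surface (persistent H-minimal graph) if it is H-minimal and is minimal in $(\mathbb{H}^1,g_\lambda)$ for all $\lambda\in[1,\infty]$, where the value $\lambda=\infty$ is understood as H-minimality.
   Formalization: The quadratic part of the formula in (1) is multiplied by −1/2: as printed the claim fails, since u = xy/2 is persistent H-minimal with Hessian eigenvalues ±1/2, while the printed surfaces have ±1 and are not H-minimal (e.g. u = −xy). *)

(* Defs.v *)
From HB Require Import structures.
From mathcomp Require Import all_boot all_order all_algebra.
From mathcomp Require Import all_classical all_reals all_analysis.
From mathcomp Require Import ring.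
Set Implicit Arguments.
Unset Strict Implicit.
Unset Printing Implicit Defensive.
Import Order.TTheory GRing.Theory Num.Theory.
Import numFieldNormedType.Exports.
Local Open Scope classical_set_scope.
Local Open Scope ring_scope.

(* A point (x, y, t) of the Heisenberg group is ((x, y), t), so that P.1 is
   its projection to the plane. Tangent vectors have the same type. *)
Notation plane R := (R * R)%type.
Notation heis R := (R * R * R)%type.

Section Frame.
Variable R : realType.
Implicit Types P v w : heis R.

Definition X1 P : heis R := (1, 0, - (P.1.2 / 2)).
Definition X2 P : heis R := (0, 1, P.1.1 / 2).
Definition T P : heis R := (0, 0, 1).

(* coordinates of the tangent vector v at P in the frame (X1, X2, T) *)
Definition c1 P v : R := v.1.1.
Definition c2 P v : R := v.1.2.
Definition c3 P v : R := v.2 + P.1.2 / 2 * v.1.1 - P.1.1 / 2 * v.1.2.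

Lemma frameE P v :
  v = c1 P v *: X1 P + c2 P v *: X2 P + c3 P v *: T P.
Proof.
case: v P => [[a b] c] [[x y] t]; rewrite /c1 /c2 /c3 /X1 /X2 /T /=.
congr (_, _, _); rewrite /= /GRing.scale /=; ring.
Qed.

End Frame.

Section CarnotCaratheodory.
Variable R : realType.
Implicit Types (P Q : heis R) (gamma : R -> heis R) (f : R -> R).

Definition abs_continuous01 f : Prop :=
  forall eps : R, 0 < eps -> exists2 delta : R, 0 < delta &
    forall (n : nat) (a b : 'I_n -> R),
      (forall i, 0 <= a i /\ a i <= b i /\ b i <= 1) ->
      trivIset setT (fun i => [set s : R | a i < s < b i]) ->
      \sum_(i < n) (b i - a i) < delta ->
      \sum_(i < n) `|f (b i) - f (a i)| < eps.

Definition horizontal_path gamma P Q : Prop :=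
  [/\ gamma 0 = P, gamma 1 = Q,
      [/\ abs_continuous01 (fun s => (gamma s).1.1),
          abs_continuous01 (fun s => (gamma s).1.2) &
          abs_continuous01 (fun s => (gamma s).2)] &
      forall s : R, 0 < s < 1 -> derivable gamma s 1 ->
        exists a b : R,
          'D_1 gamma s = a *: X1 (gamma s) + b *: X2 (gamma s)].

(* The value 0 at the (negligible) points where the path has no derivative only
   keeps the junk value of 'D_1 out of the integral. *)
Definition speed gamma (s : R) : R :=
  if `[< derivable gamma s 1 >]
  then Num.sqrt (c1 (gamma s) ('D_1 gamma s) ^+ 2
                 + c2 (gamma s) ('D_1 gamma s) ^+ 2)
  else 0.

Definition path_length gamma : \bar R :=
  (\int[lebesgue_measure]_(s in `]0%R, 1%R[) (speed gamma s)%:E)%E.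

Definition dcc P Q : \bar R :=
  ereal_inf [set path_length gamma | gamma in
    [set gamma | horizontal_path gamma P Q]].

Definition dcc_isometry (phi : heis R -> heis R) : Prop :=
  bijective phi /\ forall P Q, dcc (phi P) (phi Q) = dcc P Q.

End CarnotCaratheodory.

Section PlaneCalculus.
Variable R : realType.
Implicit Types (Omega : set (plane R)) (u : plane R -> R).

Definition domain Omega : Prop :=
  [/\ open Omega, connected Omega & Omega !=set0].

Definition e_x : plane R := (1, 0).
Definition e_y : plane R := (0, 1).

Fixpoint Ck (k : nat) Omega u : Prop :=
  (forall z, Omega z -> {for z, continuous u}) /\
  if k is k'.+1 then
    [/\ forall z, Omega z -> derivable u z e_x /\ derivable u z e_y,
        Ck k' Omega ('D_e_x u) & Ck k' Omega ('D_e_y u)]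
  else True.

Definition test_function Omega (phi : plane R -> R) : Prop :=
  [/\ forall k, Ck k setT phi,
      compact (closure [set z | phi z != 0]) &
      closure [set z | phi z != 0] `<=` Omega].

Definition graph Omega u : set (heis R) := [set (z, u z) | z in Omega].

End PlaneCalculus.

Section HMinimal.
Variable R : realType.
Implicit Types (Omega : set (plane R)) (u : plane R -> R) (z : plane R).

(* p = X1 (t - u) and q = X2 (t - u) *)
Definition p u z : R := - (z.2 / 2) - 'D_(@e_x R) u z.
Definition q u z : R := z.1 / 2 - 'D_(@e_y R) u z.

(* At characteristic points, where p = q = 0, the convention 0^-1 = 0 makes
   both quotients 0; for a C^2 graph these points form a null set. *)
Definition pbar u z : R := p u z / Num.sqrt (p u z ^+ 2 + q u z ^+ 2).
Definition qbar u z : R := q u z / Num.sqrt (p u z ^+ 2 + q u z ^+ 2).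

Definition H_minimal Omega u : Prop :=
  forall phi, test_function Omega phi ->
    (\int[(lebesgue_measure \x lebesgue_measure)%E]_(z in Omega)
       (pbar u z * 'D_(@e_x R) phi z + qbar u z * 'D_(@e_y R) phi z))%R = 0.

End HMinimal.

Section RiemannianMinimal.
Variable R : realType.
Implicit Types (Omega : set (plane R)) (u : plane R -> R) (z e f : plane R).
Implicit Types (l : R) (P v w n : heis R).

Definition g l P v w : R :=
  c1 P v * c1 P w + c2 P v * c2 P w + l ^+ 2 * (c3 P v * c3 P w).

Lemma g_orthonormal l P (l0 : l != 0) :
  [/\ g l P (X1 P) (X1 P) = 1, g l P (X2 P) (X2 P) = 1 &
      g l P (l^-1 *: T P) (l^-1 *: T P) = 1]
  /\
  [/\ g l P (X1 P) (X2 P) = 0,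
      g l P (X1 P) (l^-1 *: T P) = 0 & g l P (X2 P) (l^-1 *: T P) = 0].
Proof.
case: P => [[x y] t]; rewrite /g /c1 /c2 /c3 /X1 /X2 /T /= /GRing.scale /=.
by split; split; field.
Qed.

(* Levi-Civita connection by Koszul's formula: for the constant vector fields
   v, w, n of R^3 this is g (nabla_v w, n) at P. *)
Definition christoffel l P v w n : R :=
  ('D_v (fun Q => g l Q w n) P + 'D_w (fun Q => g l Q v n) P
   - 'D_n (fun Q => g l Q v w) P) / 2.

(* For F (x, y) = (x, y, u (x, y)): the differential of F applied to e, and
   g (nabla_e (dF f), n), which is the second fundamental form in the direction
   n when n is normal to the graph. *)
Definition tangent u z e : heis R := (e, 'D_e u z).
Definition second_form l u z e f n : R :=
  g l (z, u z) (0, 'D_e ('D_f u) z) n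
  + christoffel l (z, u z) (tangent u z e) (tangent u z f) n.

(* zero mean curvature: the trace of the second fundamental form with respect
   to the first one vanishes *)
Definition riemannian_minimal l Omega u : Prop :=
  forall z, Omega z -> forall n : heis R,
    let I e f := g l (z, u z) (tangent u z e) (tangent u z f) in
    let II e f := second_form l u z e f n in
    g l (z, u z) (tangent u z (@e_x R)) n = 0 ->
    g l (z, u z) (tangent u z (@e_y R)) n = 0 ->
    I (@e_y R) (@e_y R) * II (@e_x R) (@e_x R)
    - 2 * I (@e_x R) (@e_y R) * II (@e_x R) (@e_y R)
    + I (@e_x R) (@e_x R) * II (@e_y R) (@e_y R) = 0.

Definition persistent Omega u : Prop :=
  [/\ Ck 2 Omega u, H_minimal Omega u &
      forall l : R, 1 <= l -> riemannian_minimal l Omega u].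

End RiemannianMinimal.

Section Categories.
Variable R : realType.

(* Written with s = (X + m Y) / sqrt (1 + m^2) and r = (m X - Y) / sqrt (1 + m^2)
   for X = x - x0, Y = y - y0, this is - r s / 2 + a s + b. The factor - 1 / 2
   is forced by the normalization of X1 and X2: it is the rate at which height
   changes along horizontal lines. Without it the quadratic part at m = 0 would
   be - X Y, for which (a = b = x0 = y0 = 0) p = y / 2 and q = 3 x / 2, and
   (pbar, qbar) is not divergence free. *)
Definition hyperbolic (m a b x0 y0 : R) (z : plane R) : R :=
  - 2^-1 * (m / (1 + m ^+ 2) * (z.1 - x0) ^+ 2
            + (m ^+ 2 - 1) / (m ^+ 2 + 1) * (z.1 - x0) * (z.2 - y0)
            - m / (1 + m ^+ 2) * (z.2 - y0) ^+ 2)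
  + a / Num.sqrt (1 + m ^+ 2) * (z.1 - x0)
  + a * m / Num.sqrt (1 + m ^+ 2) * (z.2 - y0) + b.

Definition helicoid (a b : R) : set (heis R) :=
  [set P | exists rho theta : R, 0 <= rho /\
    P = (rho * cos theta, rho * sin theta, a * theta + b)].

End Categories.

(* Main.v *)
(* Writing the minimal surface equation of g_l for a graph t = u (x, y) as
   Lap u + l^2 (q^2 u_xx - 2 p q u_xy + p^2 u_yy) = 0, minimality for two values
   of l already makes both terms vanish. So phi = -2i (u_x - i u_y) is
   holomorphic, and the second equation says that (z + conj phi)^2 phi' is real.
   Applying d/dz twice and eliminating conj phi' gives 2 phi' phi''' = 3 phi''^2
   wherever z + conj phi <> 0, hence everywhere by density: the Schwarzian
   derivative of phi vanishes and phi is constant, affine or a Moebius map with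
   a pole. Inserting these back leaves planes (left translates of t = 0), the
   quadratic graphs, with phi = c z + d and |c| = 1, and
   phi = - conj s - k / (z - s) with k real, whose graph is a translated
   helicoid. The value c = 1 is the missing slope m = oo of the quadratic family
   and is removed by a quarter turn.
   The smoothness of phi needed for phi''' comes from the mean value formula
   2 pi r phi' (z) = int_0^(2 pi) phi (z + r e^(i t)) e^(- i t) dt, which shows
   that the derivative of a C^1 holomorphic function is again C^1. *)

(* The calculation treats z and conj z as independent variables. Since d/dz annihilates conj phi',
   the ruling equation and its two z-derivatives are three relations in which conj phi' is never
   differentiated, and it can be eliminated algebraically. No power series or identity theorem is
   involved: global conclusions come from exhibiting a quantity whose two Wirtinger derivatives
   vanish and then using connectedness. The vanishing Schwarzian is integrated in this way: for a
   Moebius map 1 / phi' is the square of an affine function, and the coefficients of that square are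
   the quantities shown to be constant. Inserting the solutions back again uses only derivatives in
   z and conj z. Since Omega need not be simply connected, the polar angle around the pole of phi
   may have no branch on it. The helicoid is therefore recognised from u itself: suitably translated
   and scaled, u is an angle function, and the radial unit vector rotated back by it is constant. *)
Require Import Defs.
From mathcomp Require Import all_boot all_order all_algebra.
From mathcomp Require Import all_classical all_reals all_analysis.
From mathcomp Require Import complex.
From mathcomp Require Import ring lra.
Set Implicit Arguments.
Unset Strict Implicit.
Unset Printing Implicit Defensive.
Import Order.TTheory GRing.Theory Num.Theory.
Import numFieldNormedType.Exports.
Local Open Scope classical_set_scope.
Local Open Scope ring_scope.

(** * Calculus in the plane *)

Section DirectionalCalculus.
Variables (R : realType) (V : normedModType R).
Implicit Types (f : V -> R) (z v : V).

Lemma is_derive_line f z v (t : R) : derivable f (t *: v + z) v ->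
  is_derive t 1 (fun s : R => f (s *: v + z)) ('D_v f (t *: v + z)).
Proof.
move=> df.
have E : (fun h : R => h^-1 *: (((fun s : R => f (s *: v + z)) \o shift t)
    (h *: 1) - f (t *: v + z))) =
    (fun h => h^-1 *: ((f \o shift (t *: v + z)) (h *: v) - f (t *: v + z))).
  by apply/funext => h /=; rewrite [h *: 1]mulr1 scalerDl addrA.
split; first by rewrite /derivable E.
by rewrite /derive E.
Qed.

(** The segment is parametrised by s in [0, 1] with t = s h, so that one argument covers both signs
    of h. *)
Lemma MVT_dir f z v (h : R) :
  (forall t : R, `|t| <= `|h| -> derivable f (t *: v + z) v) ->
  exists2 t : R, `|t| <= `|h| &
    f (h *: v + z) - f z = h * 'D_v f (t *: v + z).
Proof.
move=> df.
have hb (s : R) : 0 <= s <= 1 -> `|s * h| <= `|h|.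
  move=> /andP[s0 s1]; rewrite normrM ger0_norm//.
  by rewrite ler_piMl.
have D (s : R) : 0 <= s <= 1 ->
    is_derive s 1 (fun s : R => f ((s * h) *: v + z))
                  (h * 'D_v f ((s * h) *: v + z)).
  move=> s01.
  rewrite -[X in is_derive _ _ X _]/((fun t : R => f (t *: v + z)) \o
    (fun s : R => s * h)).
  rewrite [h * _]mulrC; apply: is_derive1_comp.
    by apply: is_derive_line; exact/df/hb.
  have -> : (fun s : R => s * h) = h \*: (@id R).
    by apply/funext => x /=; rewrite mulrC.
  apply: is_derive_eq.
  by rewrite [LHS]mulr1.
have cf : {within `[0, 1], continuous (fun s : R => f ((s * h) *: v + z))}.
  apply: derivable_within_continuous => x; rewrite in_itv/= => /D D1.
  by case: D1.
have D' (s : R) : s \in `]0, 1[ -> is_derive s 1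
    (fun s : R => f ((s * h) *: v + z)) (h * 'D_v f ((s * h) *: v + z)).
  by move/subset_itv_oo_cc; rewrite in_itv; exact: D.
have [c] := MVT_segment ler01 D' cf.
rewrite in_itv/= => c01; rewrite mul1r mul0r scale0r add0r subr0 mulr1 => e.
by exists (c * h) => //; exact: hb.
Qed.

End DirectionalCalculus.

Lemma cvg_pair2 (X : Type) (U V : topologicalType) (F : set_system X)
    (f : X -> U) (g : X -> V) (a : U) (b : V) {FF : Filter F} :
  f x @[x --> F] --> a -> g x @[x --> F] --> b ->
  (f x, g x) @[x --> F] --> (a, b).
Proof. by move=> fa gb; exact: (cvg_pair fa gb). Qed.

Section Slope.
Variables (R : realType) (V : normedModType R).
Implicit Types (f : V -> R) (z v : V).

(** Putting the derivative at step 0 makes [slopeE] hold for every step. In the chain rule the steps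
    are increments of a curve, which may vanish although the parameter moves. *)
Definition slope f v z (p : V * R) : R :=
  if p.2 == 0 then 'D_v f z else p.2^-1 * (f (p.2 *: v + p.1) - f p.1).

Lemma slopeE f v z w (h : R) : f (h *: v + w) - f w = h * slope f v z (w, h).
Proof.
rewrite /slope /=; case: eqVneq => [->|h0]; first by rewrite scale0r add0r subrr mul0r.
by rewrite mulrA mulfV// mul1r.
Qed.

(* The derivative along v is strict wherever it is continuous: the base point of
   the difference quotient may move together with the step. *)
Lemma slope_cvg f v z : (\forall w \near z, derivable f w v) ->
  {for z, continuous ('D_v f)} -> slope f v z p @[p --> (z, 0)] --> 'D_v f z.
Proof.
move=> fd fc; apply/cvgrPdist_le => e e0.
have : \forall w \near z, derivable f w v /\ `|'D_v f z - 'D_v f w| <= e.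
  by apply: filterI => //; move/cvgrPdist_le : fc; exact.
move=> /nbhs_ballP[d /= d0 zd].
have Hn : \forall p \near (z, 0 : R), ball z (d / 2) p.1 /\ `|p.2| * `|v| < d / 2.
  have d2 : 0 < d / 2 by rewrite divr_gt0.
  apply: filterI; first by apply: (@cvg_fst _ _ (nbhs z) (nbhs (0:R))); exact: nbhsx_ballx.
  have : (fun p : V * R => `|p.2| * `|v|) p @[p --> (z, 0 : R)] --> `|(0 : R)| * `|v|.
    apply: cvgM; last exact: cvg_cst.
    by apply: cvg_norm; exact: cvg_snd.
  by rewrite normr0 mul0r => /cvgr_lt; apply.
apply: filterS Hn => -[w h] /= [zw hv].
have H (t : R) : `|t| <= `|h| -> ball z d (t *: v + w).
  move=> th; move: zw; rewrite -!ball_normE /ball_/= => zw.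
  rewrite (_ : z - _ = (z - w) - t *: v); last by rewrite opprD addrA addrAC.
  rewrite (le_lt_trans (ler_normB _ _))// (splitr d) ltrD// normrZ.
  by rewrite (le_lt_trans _ hv)// ler_wpM2r.
rewrite /slope /=; case: eqVneq => [_|h0]; first by rewrite subrr normr0 ltW.
have [t th ->] := MVT_dir (fun t th => (zd _ (H t th)).1).
by rewrite mulrA mulVf// mul1r; exact: (zd _ (H t th)).2.
Qed.

End Slope.

Lemma is_derive1P (R : realType) (c : R -> R) (t d : R) :
  is_derive t 1 c d <-> h^-1 *: (c (h + t) - c t) @[h --> 0^'] --> d.
Proof.
have E : (fun h : R => h^-1 *: ((c \o shift t) (h *: 1) - c t)) =
  (fun h : R => h^-1 *: (c (h + t) - c t)).
  by apply/funext => h; rewrite /= [h *: 1]mulr1.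
split=> [[]|H].
  by rewrite /derivable /derive E => dc <-.
by split; [rewrite /derivable E; apply/cvg_ex; exists d|rewrite /derive E; exact/cvg_lim].
Qed.

Lemma is_derive1_cvg (R : realType) (c : R -> R) (t d : R) :
  is_derive t 1 c d -> c (h + t) @[h --> 0^'] --> c t.
Proof.
move=> [dc _].
have cc : {for t, continuous c}.
  exact/differentiable_continuous/derivable1_diffP.
have ht : h + t @[h --> 0^'] --> t.
  rewrite -[X in _ --> X]add0r; apply: cvgD; last exact: cvg_cst.
  exact/cvg_within.
exact: (cvg_comp _ _ ht cc).
Qed.

Section PlaneC1.
Variable R : realType.
Implicit Types (Omega : set (plane R)) (f : plane R -> R) (z : plane R).
Local Notation ex := (@e_x R).
Local Notation ey := (@e_y R).

Lemma scale_ex (h : R) z : h *: ex + z = (z.1 + h, z.2).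
Proof.
by case: z => x y; congr pair; rewrite /= /GRing.scale /= ?mulr1 ?mulr0 ?add0r // addrC.
Qed.

Lemma scale_ey (h : R) z : h *: ey + z = (z.1, z.2 + h).
Proof.
by case: z => x y; congr pair; rewrite /= /GRing.scale /= ?mulr1 ?mulr0 ?add0r // addrC.
Qed.

Lemma Ck1P Omega f : Ck 1 Omega f <->
  (forall z, Omega z -> [/\ derivable f z ex, derivable f z ey,
     {for z, continuous f}, {for z, continuous ('D_ex f)} &
     {for z, continuous ('D_ey f)}]).
Proof.
split=> [[fc [fd [fx _] [fy _]]] z Oz|H].
  have [dx dy] := fd z Oz.
  by split; [exact: dx|exact: dy|exact: fc|exact: fx|exact: fy].
split=> [z /H[_ _ fz _ _]|]; first exact: fz.
split=> [z /H[dx dy _ _ _]| |]; first by split; [exact: dx|exact: dy].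
  by split=> [z /H[_ _ _ fx _]|]; [exact: fx|exact: I].
by split=> [z /H[_ _ _ _ fy]|]; [exact: fy|exact: I].
Qed.

(** The increment of f is split into a horizontal step taken at the new height c2 (h + t) and a
    vertical step at the old abscissa. The base point of the first step moves with h, which is why
    the strict limit [slope_cvg] is needed. *)
Lemma is_derive_curve Omega f (c1 c2 : R -> R) (t d1 d2 : R) :
  open Omega -> Ck 1 Omega f -> Omega (c1 t, c2 t) ->
  is_derive t 1 c1 d1 -> is_derive t 1 c2 d2 ->
  is_derive t 1 (fun s => f (c1 s, c2 s))
    (d1 * 'D_ex f (c1 t, c2 t) + d2 * 'D_ey f (c1 t, c2 t)).
Proof.
move=> oO /Ck1P fC Oct D1 D2.
set z := (c1 t, c2 t).
have nO : \forall w \near z, Omega w by apply: open_nbhs_nbhs.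
have [_ _ _ cx cy] := fC _ Oct.
have sx : slope f ex z p @[p --> (z, 0)] --> 'D_ex f z.
  by apply: slope_cvg; [apply: filterS nO => w /fC[dx dy _ _ _]; exact: dx|exact: cx].
have sy : slope f ey z p @[p --> (z, 0)] --> 'D_ey f z.
  by apply: slope_cvg; [apply: filterS nO => w /fC[dx dy _ _ _]; exact: dy|exact: cy].
have c1c := is_derive1_cvg D1.
have c2c := is_derive1_cvg D2.
have h1 : c1 (h + t) - c1 t @[h --> 0^'] --> 0.
  by rewrite -[X in _ --> X](subrr (c1 t)); apply: cvgB => //; exact: cvg_cst.
have h2 : c2 (h + t) - c2 t @[h --> 0^'] --> 0.
  by rewrite -[X in _ --> X](subrr (c2 t)); apply: cvgB => //; exact: cvg_cst.
apply/is_derive1P.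
have -> : (fun h : R => h^-1 *: (f (c1 (h + t), c2 (h + t)) - f (c1 t, c2 t)))
  = (fun h => (h^-1 *: (c1 (h + t) - c1 t)) *
              slope f ex z ((c1 t, c2 (h + t)), c1 (h + t) - c1 t)
            + (h^-1 *: (c2 (h + t) - c2 t)) *
              slope f ey z ((c1 t, c2 t), c2 (h + t) - c2 t)).
  apply/funext => h; rewrite -!scalerAl -scalerDr; congr (_ *: _).
  by rewrite -!slopeE scale_ex scale_ey /= !subrKC addrA subrK.
apply: cvgD; apply: cvgM.
- exact/is_derive1P.
- have hz : (c1 t, c2 (h + t), c1 (h + t) - c1 t) @[h --> 0^'] --> (z, 0 : R).
    have hc : (fun=> c1 t) h @[h --> (0 : R)^'] --> c1 t by exact: cvg_cst.
    exact: (cvg_pair2 (cvg_pair2 hc c2c) h1).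
  exact: (cvg_comp _ _ hz sx).
- exact/is_derive1P.
- have hz : (c1 t, c2 t, c2 (h + t) - c2 t) @[h --> 0^'] --> (z, 0 : R).
    have hc : (fun=> z) h @[h --> (0 : R)^'] --> z by exact: cvg_cst.
    exact: (cvg_pair2 hc h2).
  exact: (cvg_comp _ _ hz sy).
Qed.

End PlaneC1.

(** * Symmetry of mixed derivatives, and constancy on planar domains *)

Section SecondDifference.
Variables (R : realType) (V : normedModType R).
Implicit Types (f : V -> R) (u v w z : V).

Lemma is_derive_translate f w u v : derivable f (w + u) v ->
  is_derive u v (fun x => f (w + x)) ('D_v f (w + u)).
Proof.
move=> df.
have E : (fun h : R => h^-1 *: (((fun x => f (w + x)) \o shift u) (h *: v) - f (w + u))) =
    (fun h => h^-1 *: ((f \o shift (w + u)) (h *: v) - f (w + u))).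
  by apply/funext => h /=; rewrite addrCA.
by split; [rewrite /derivable E|rewrite /derive E].
Qed.

Lemma is_derive_affine f z v (d : R) :
  (forall h : R, f (h *: v + z) - f z = h * d) -> is_derive z v f d.
Proof.
move=> fE.
have H : h^-1 *: ((f \o shift z) (h *: v) - f z) @[h --> (0 : R)^'] --> d.
  have E : \forall h \near (0 : R)^', d = h^-1 *: ((f \o shift z) (h *: v) - f z).
    near=> h; rewrite /= fE /GRing.scale /= mulrA mulVf ?mul1r//.
    by near: h; exact: withinT.
  by apply: cvg_trans (near_eq_cvg E) _; exact: cvg_cst.
split; first by rewrite /derivable; apply/cvg_ex; exists d.
by rewrite /derive; exact/cvg_lim.
Unshelve. all: by end_near. Qed.

(** The mean value theorem is applied along v to the increment of f in the direction w, then along w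
    to the derivative of f along v. The left side is symmetric in v and w, so the two orders of
    differentiation can be compared. *)
Lemma second_difference f v w z (h : R) :
  (forall s t : R, `|s| <= `|h| -> `|t| <= `|h| ->
     derivable f (t *: w + (s *: v + z)) v /\
     derivable ('D_v f) (t *: w + (s *: v + z)) w) ->
  exists s t : R, [/\ `|s| <= `|h|, `|t| <= `|h| &
    f (h *: w + (h *: v + z)) - f (h *: v + z) - (f (h *: w + z) - f z)
    = h * (h * 'D_w ('D_v f) (t *: w + (s *: v + z)))].
Proof.
move=> df.
pose g u := f (h *: w + u) - f u.
have Dg (s : R) : `|s| <= `|h| -> is_derive (s *: v + z) v g
    ('D_v f (h *: w + (s *: v + z)) - 'D_v f (s *: v + z)).
  move=> sh.
  have D1 := is_derive_translate (df s h sh (lexx _)).1.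
  have D2 : is_derive (s *: v + z) v f ('D_v f (s *: v + z)).
    apply: derivableP.
    by have := (df s 0 sh); rewrite normr0 scale0r add0r; case/(_ (normr_ge0 _)).
  exact: is_deriveB.
have [s sh E1] : exists2 s : R, `|s| <= `|h| & g (h *: v + z) - g z = h * 'D_v g (s *: v + z).
  by apply: MVT_dir => s /Dg [].
have [t th E2] := MVT_dir (fun t th => (df s t sh th).2).
exists s, t; split=> //.
by rewrite -E2 -[RHS]/(h * _) -(@derive_val _ _ _ _ _ _ _ (Dg s sh)) -E1.
Qed.

End SecondDifference.

Section Plane.
Variable R : realType.
Implicit Types (Omega : set (plane R)) (f : plane R -> R) (z w : plane R).
Local Notation ex := (@e_x R).
Local Notation ey := (@e_y R).

Lemma plane_ballP z w (e : R) :
  ball z e w <-> `|z.1 - w.1| < e /\ `|z.2 - w.2| < e.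
Proof.
rewrite -ball_normE /ball_/=.
have -> : `|z - w| = Num.max `|z.1 - w.1| `|z.2 - w.2| by [].
by rewrite gt_max; split=> [/andP[]|[-> ->]].
Qed.

Lemma Ck2P Omega f : Ck 2 Omega f <->
  [/\ Ck 1 Omega f, Ck 1 Omega ('D_ex f) & Ck 1 Omega ('D_ey f)].
Proof.
split=> [[fc [fd fx fy]]|[[fc [fd _ _]] fx fy]]; last by split; [exact: fc|split; [exact: fd|exact: fx|exact: fy]].
split; [|exact: fx|exact: fy].
split; first exact: fc.
by split; [exact: fd|split; [exact: fx.1|exact: I]|split; [exact: fy.1|exact: I]].
Qed.

Lemma Ck2_symmetric Omega f z : open Omega -> Ck 2 Omega f -> Omega z ->
  'D_ex ('D_ey f) z = 'D_ey ('D_ex f) z.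
Proof.
move=> oO /Ck2P[/Ck1P f1 /Ck1P fx /Ck1P fy] Oz.
have [_ _ _ _ cxy] := fx z Oz.
have [_ _ _ cyx _] := fy z Oz.
apply/eqP; rewrite -subr_eq0 -normr_le0; apply/ler_addgt0Pr => e e0.
have : \forall w \near z, [/\ Omega w, `|'D_ey ('D_ex f) z - 'D_ey ('D_ex f) w| <= e / 2
    & `|'D_ex ('D_ey f) z - 'D_ex ('D_ey f) w| <= e / 2].
  have e2 : 0 < e / 2 by rewrite divr_gt0.
  move/cvgrPdist_le : cxy => /(_ _ e2) N1; move/cvgrPdist_le : cyx => /(_ _ e2) N2.
  have N0 : \forall w \near z, Omega w by apply: open_nbhs_nbhs.
  apply: filterS (filterI N0 (filterI N1 N2)) => w [Ow [wx wy]].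
  by split; [exact: Ow|exact: wx|exact: wy].
move=> /nbhs_ballP[d /= d0 zd].
pose h := d / 2.
have h0 : 0 < h by rewrite divr_gt0.
have hd : `|h| < d by rewrite ger0_norm ?(ltW h0)// /h ltr_pdivrMr// ltr_pMr// ltr1n.
have B1 (s t : R) : `|s| <= `|h| -> `|t| <= `|h| -> ball z d (t *: ey + (s *: ex + z)).
  move=> sh th; apply/plane_ballP; rewrite scale_ey scale_ex /= !opprD !addNKr !normrN.
  by split; apply: le_lt_trans hd.
have B2 (s t : R) : `|s| <= `|h| -> `|t| <= `|h| -> ball z d (t *: ex + (s *: ey + z)).
  by move=> sh th; rewrite addrCA; exact: B1.
have [s [t [sh th E]]] := @second_difference R (plane R) f ex ey z h
  (fun s t sh th => let Ow := (let: And3 a _ _ := zd _ (B1 s t sh th) in a) in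
    conj (let: And5 a _ _ _ _ := f1 _ Ow in a) (let: And5 _ a _ _ _ := fx _ Ow in a)).
have [s' [t' [sh' th' E']]] := @second_difference R (plane R) f ey ex z h
  (fun s t sh th => let Ow := (let: And3 a _ _ := zd _ (B2 s t sh th) in a) in
    conj (let: And5 _ a _ _ _ := f1 _ Ow in a) (let: And5 a _ _ _ _ := fy _ Ow in a)).
(* One second difference read in both orders equates the two mixed derivatives at points near z;
   their continuity then compares them at z. *)
have EE : 'D_ey ('D_ex f) (t *: ey + (s *: ex + z)) =
          'D_ex ('D_ey f) (t' *: ex + (s' *: ey + z)).
  apply: (mulfI (lt0r_neq0 h0)); apply: (mulfI (lt0r_neq0 h0)).
  move: E E'; rewrite (addrCA (h *: ex) (h *: ey) z).
  move: (f (h *: ey + (h *: ex + z))) (f (h *: ex + z)) (f (h *: ey + z)) (f z).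
  move=> A B C D E E'.
  have K : A - B - (C - D) = A - C - (B - D) by ring.
  exact: etrans (esym E) (etrans K E').
have [_ Hx _] := zd _ (B1 s t sh th).
have [_ _ Hy] := zd _ (B2 s' t' sh' th').
move: Hx Hy; rewrite EE.
clear -e0.
move: ('D_ex ('D_ey f) z) ('D_ey ('D_ex f) z) ('D_ex ('D_ey f) _) => a b c Hx Hy.
rewrite add0r (_ : a - b = (a - c) - (b - c)); last by ring.
by rewrite (le_trans (ler_normB _ _))// (splitr e) lerD.
Qed.

(** The points of Omega where P holds form a relatively clopen set. *)
Lemma connected_propagate Omega (P : plane R -> Prop) : open Omega -> connected Omega ->
  (forall z, Omega z -> P z -> \forall w \near z, P w) ->
  (forall z, Omega z -> ~ P z -> \forall w \near z, ~ P w) ->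
  forall z0, Omega z0 -> P z0 -> forall z, Omega z -> P z.
Proof.
move=> oO cO PP nPP z0 Oz0 Pz0 z Oz.
suff : Omega `&` P = Omega by move=> E; have : Omega z := Oz; rewrite -E => -[].
apply: cO.
- by exists z0.
- exists (Omega `&` P); last by rewrite setIA setIid.
  rewrite openE => w [Ow Pw]; apply: filterI; first exact: open_nbhs_nbhs.
  exact: PP.
- exists (~` (Omega `&` ~` P)).
    apply: open_closedC; rewrite openE => w [Ow Pw].
    by apply: filterI; [exact: open_nbhs_nbhs|exact: nPP].
  apply/seteqP; split=> w /= [Ow Pw]; split => //; first by case.
  by apply: contrapT => nPw; apply: Pw; split.
Qed.

(** Balls of the product norm are squares, so the broken path from z to w through (w.1, z.2) stays
    inside, and the mean value theorem applies on each leg. *)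
Lemma ball_constant z (e : R) f :
  (forall w, ball z e w -> [/\ derivable f w ex, derivable f w ey,
     'D_ex f w = 0 & 'D_ey f w = 0]) ->
  forall w, ball z e w -> f w = f z.
Proof.
move=> H w /plane_ballP[w1 w2].
have e0 : 0 < e by apply: le_lt_trans w1.
have B (s t : R) : `|s| <= `|w.1 - z.1| -> `|t| <= `|w.2 - z.2| -> ball z e (z.1 + s, z.2 + t).
  move=> ss tt; apply/plane_ballP; rewrite /= !opprD !addNKr !normrN; split.
    by apply: le_lt_trans w1; rewrite distrC.
  by apply: le_lt_trans w2; rewrite distrC.
have Bx (s : R) : `|s| <= `|w.1 - z.1| -> ball z e (s *: ex + z).
  move=> ss; rewrite scale_ex; have := B s 0 ss; rewrite normr0 addr0; exact.
have By (t : R) : `|t| <= `|w.2 - z.2| -> ball z e (t *: ey + (w.1, z.2)).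
  move=> tt; rewrite scale_ey/=; have := B (w.1 - z.1) t (lexx _) tt.
  by rewrite subrKC.
have [s ss E1] := @MVT_dir R (plane R) f z ex (w.1 - z.1)
  (fun s ss => let: And4 a _ _ _ := H _ (Bx s ss) in a).
have [t tt E2] := @MVT_dir R (plane R) f (w.1, z.2) ey (w.2 - z.2)
  (fun s ss => let: And4 _ a _ _ := H _ (By s ss) in a).
move: E1 E2; have [_ _ -> _] := H _ (Bx _ ss); have [_ _ _ ->] := H _ (By _ tt).
rewrite !mulr0 scale_ex scale_ey /= !subrKC => /subr0_eq E1 /subr0_eq E2.
by rewrite -E1 -E2; case: (w).
Qed.

Lemma domain_constant Omega f : domain Omega ->
  (forall w, Omega w -> [/\ derivable f w ex, derivable f w ey,
     'D_ex f w = 0 & 'D_ey f w = 0]) ->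
  exists c, forall z, Omega z -> f z = c.
Proof.
move=> [oO cO [z0 Oz0]] H; exists (f z0).
have L z : Omega z -> \forall w \near z, f w = f z.
  move=> Oz; have /nbhs_ballP[e /= e0 zeO] : nbhs z Omega by exact: open_nbhs_nbhs.
  apply/nbhs_ballP; exists e => //= w; apply: ball_constant => w' /zeO; exact: H.
apply: (connected_propagate oO cO _ _ Oz0) => // z Oz Pz; apply: filterS (L z Oz) => w ->//.
Qed.

End Plane.

(** * Circle means and regularity of Cauchy-Riemann pairs *)

Section CircleIntegral.
Variable R : realType.
Implicit Types (f g k : R -> R).

Definition circle_int g : R :=
  \int[@lebesgue_measure R]_(t in `[0%R, (pi *+ 2 : R)]) g t.

Lemma twopi_gt0 : 0 < pi *+ 2 :> R.
Proof. by rewrite mulrn_wgt0// pi_gt0. Qed.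

Lemma circle_integrable g : continuous g ->
  (@lebesgue_measure R).-integrable `[0%R, (pi *+ 2 : R)] (EFin \o g).
Proof.
move=> gc; apply: continuous_compact_integrable; first exact: segment_compact.
exact: continuous_subspaceT.
Qed.

Lemma circle_intD f g : continuous f -> continuous g ->
  circle_int (fun t => f t + g t) = circle_int f + circle_int g.
Proof. by move=> fc gc; rewrite /circle_int RintegralD//; exact: circle_integrable. Qed.

Lemma circle_intB f g : continuous f -> continuous g ->
  circle_int (fun t => f t - g t) = circle_int f - circle_int g.
Proof. by move=> fc gc; rewrite /circle_int RintegralB//; exact: circle_integrable. Qed.

Lemma circle_intZ (c : R) g : continuous g ->
  circle_int (fun t => c * g t) = c * circle_int g.
Proof. by move=> gc; rewrite /circle_int RintegralZl//; exact: circle_integrable. Qed.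

Lemma circle_int_cst (c : R) : circle_int (fun=> c) = (pi *+ 2) * c.
Proof.
rewrite /circle_int Rintegral_cst//= lebesgue_measure_itv/= lte_fin twopi_gt0/=.
by rewrite subr0 mulrC.
Qed.

Lemma circle_int_norm g (e : R) : continuous g ->
  (forall t, 0 <= t <= pi *+ 2 -> `|g t| <= e) -> `|circle_int g| <= (pi *+ 2) * e.
Proof.
move=> gc ge; rewrite -circle_int_cst.
apply: le_trans (le_normr_Rintegral _ (circle_integrable gc)) _ => //.
apply: le_Rintegral => //.
- apply: (@circle_integrable (fun t => `|g t|)) => t.
  by apply: cvg_norm; exact: gc.
- by apply: circle_integrable => t; exact: cvg_cst.
Qed.

Lemma circle_int_derive g (dg : R -> R) : continuous dg -> (forall t : R, is_derive t 1 g (dg t)) ->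
  circle_int dg = g (pi *+ 2) - g 0.
Proof.
move=> dgc D.
have gc t : {for t, continuous g}.
  by apply/differentiable_continuous/derivable1_diffP; case: (D t).
rewrite /circle_int /Rintegral (continuous_FTC2 twopi_gt0 (F := g))//.
- exact: continuous_subspaceT.
- split.
  + by move=> x _; case: (D x).
  + exact/cvg_at_right_filter/gc.
  + exact/cvg_at_left_filter/gc.
- by move=> x _; rewrite derive1E; case: (D x).
Qed.

(* Compactness turns the joint limit at each angle into a uniform limit. *)
Lemma circle_int_cvg (I : Type) (F : set_system I) {FF : Filter F}
    (g_ : I -> R -> R) g : (\forall i \near F, continuous (g_ i)) -> continuous g ->
  (forall t, g_ p.2 p.1 @[p --> (t, F)] --> g t) ->
  circle_int (g_ i) @[i --> F] --> circle_int g.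
Proof.
move=> g_c gc cvg_g; apply/cvgrPdist_le => e e0.
have e1 : 0 < e / (pi *+ 2) by rewrite divr_gt0// twopi_gt0.
have U : \forall i \near F, forall t, 0 <= t <= pi *+ 2 -> `|g t - g_ i t| <= e / (pi *+ 2).
  have /compact_near_coveringP := @segment_compact R 0 (pi *+ 2).
  move=> /(_ I F (fun i t => `|g t - g_ i t| <= e / (pi *+ 2)) FF) H.
  have {}H : \forall i \near F, `[0, pi *+ 2] `<=` (fun t : R => `|g t - g_ i t| <= e / (pi *+ 2)).
    apply: H => t _.
    have e2 : 0 < e / (pi *+ 2) / 2 by rewrite divr_gt0.
    have H1 : \forall p \near (t, F), `|g t - g_ p.2 p.1| <= e / (pi *+ 2) / 2.
      by move/cvgrPdist_le : (cvg_g t); exact.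
    have H2 : \forall p \near (t, F), `|g t - g p.1| <= e / (pi *+ 2) / 2.
      have := gc t => /cvgrPdist_le/(_ _ e2) N.
      exists ([set s | `|g t - g s| <= e / (pi *+ 2) / 2], setT) => /=.
        by split; [exact: N|exact: filterT].
      by move=> [s i] [].
    near=> p.
    have -> : g p.1 - g_ p.2 p.1 = (g t - g_ p.2 p.1) - (g t - g p.1) by ring.
    rewrite (le_trans (ler_normB _ _))// (splitr (e / _)) lerD//.
      by near: p.
    by near: p.
  by apply: filterS H => i H t t02; apply: H; rewrite /= in_itv.
near=> i.
have gic : continuous (g_ i) by near: i.
rewrite -circle_intB//.
have -> : e = pi *+ 2 * (e / (pi *+ 2)) by rewrite mulrC divfK// gt_eqF// twopi_gt0.
apply: circle_int_norm.
  by move=> t; apply: cvgB; [exact: gc|exact: gic].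
by near: i.
Unshelve. all: by end_near. Qed.

End CircleIntegral.

Section CircleMeans.
Variable R : realType.
Implicit Types (Omega : set (plane R)) (f : plane R -> R) (z w : plane R)
  (k : R -> R) (r s t : R).
Local Notation ex := (@e_x R).
Local Notation ey := (@e_y R).

Definition circ z r t : plane R := (z.1 + r * cos t, z.2 + r * sin t).

Lemma circ_cvg z r t :
  circ p.2.1 p.2.2 p.1 @[p --> (t, (z, r))] --> circ z r t.
Proof.
have c2 : p.2 @[p --> (t, (z, r))] --> (z, r) by exact: cvg_snd.
have cz : p.2.1 @[p --> (t, (z, r))] --> z by exact: (cvg_comp _ _ c2 cvg_fst).
have cr : p.2.2 @[p --> (t, (z, r))] --> r by exact: (cvg_comp _ _ c2 cvg_snd).
have cz1 : p.2.1.1 @[p --> (t, (z, r))] --> z.1.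
  by apply: (cvg_comp _ _ cz); case: (z) => x y; exact: cvg_fst.
have cz2 : p.2.1.2 @[p --> (t, (z, r))] --> z.2.
  by apply: (cvg_comp _ _ cz); case: (z) => x y; exact: cvg_snd.
have ct : p.1 @[p --> (t, (z, r))] --> t by exact: cvg_fst.
apply: cvg_pair2.
  apply: cvgD => //; apply: cvgM => //.
  exact: (cvg_comp _ _ ct (continuous_cos (x := t))).
apply: cvgD => //; apply: cvgM => //.
exact: (cvg_comp _ _ ct (continuous_sin (x := t))).
Qed.

Lemma circ_continuous z r : continuous (circ z r).
Proof.
move=> t; apply: cvg_pair2.
  apply: cvgD; first exact: cvg_cst.
  by apply: cvgM; [exact: cvg_cst|exact: continuous_cos].
apply: cvgD; first exact: cvg_cst.
by apply: cvgM; [exact: cvg_cst|exact: continuous_sin].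
Qed.

Lemma circle_int_circ_cvg Omega f k z r : continuous k ->
  (forall w, Omega w -> {for w, continuous f}) ->
  (\forall q \near (z, r), forall t, Omega (circ q.1 q.2 t)) ->
  circle_int (fun t => f (circ q.1 q.2 t) * k t) @[q --> (z, r)] -->
    circle_int (fun t => f (circ z r t) * k t).
Proof.
move=> kc fc nO.
have Ozr : forall t, Omega (circ z r t) by exact: (nbhs_singleton nO).
have L q : (forall t, Omega (circ q.1 q.2 t)) ->
    continuous (fun t => f (circ q.1 q.2 t) * k t).
  move=> Oq t; apply: cvgM; last exact: kc.
  exact: (cvg_comp _ _ (@circ_continuous q.1 q.2 t) (fc _ (Oq t))).
apply: (@circle_int_cvg R _ (nbhs (z, r)) _
  (fun q t => f (circ q.1 q.2 t) * k t)).
- by apply: filterS nO => q; exact: L.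
- exact: (L (z, r)).
- move=> t; apply: cvgM.
    exact: (cvg_comp _ _ (@circ_cvg z r t) (fc _ (Ozr t))).
  have ct : p.1 @[p --> (t, (z, r))] --> t by exact: cvg_fst.
  exact: (cvg_comp _ _ ct (kc t)).
Qed.

(** Differentiation under the integral sign along a curve displaced with velocity (a1, a2). The
    velocity (cos, sin) gives the radial derivative of a circle mean, a constant velocity its
    derivative in the centre. The difference quotients converge jointly in the angle and the step,
    so [circle_int_cvg] applies. *)
Lemma circle_int_slope_cvg Omega f k (c1 c2 a1 a2 : R -> R) : open Omega ->
  Ck 1 Omega f -> continuous k ->
  continuous c1 -> continuous c2 -> continuous a1 -> continuous a2 ->
  (\forall h \near (0 : R), forall t, Omega (c1 t + h * a1 t, c2 t + h * a2 t)) ->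
  h^-1 * (circle_int (fun t => f (c1 t + h * a1 t, c2 t + h * a2 t) * k t)
          - circle_int (fun t => f (c1 t, c2 t) * k t)) @[h --> 0^'] -->
  circle_int (fun t => (a1 t * 'D_ex f (c1 t, c2 t) + a2 t * 'D_ey f (c1 t, c2 t)) * k t).
Proof.
move=> oO /Ck1P fC kc c1c c2c a1c a2c nO.
have O0 t : Omega (c1 t, c2 t).
  by have := nbhs_singleton nO t; rewrite !mul0r !addr0.
have L h : (forall t, Omega (c1 t + h * a1 t, c2 t + h * a2 t)) ->
    continuous (fun t => f (c1 t + h * a1 t, c2 t + h * a2 t) * k t).
  move=> Oh t; apply: cvgM; last exact: kc.
  have cc : (c1 t' + h * a1 t', c2 t' + h * a2 t') @[t' --> t] -->
      (c1 t + h * a1 t, c2 t + h * a2 t).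
    apply: cvg_pair2.
      apply: cvgD; first exact: c1c.
      by apply: cvgM; [exact: cvg_cst|exact: a1c].
    apply: cvgD; first exact: c2c.
    by apply: cvgM; [exact: cvg_cst|exact: a2c].
  by apply: (cvg_comp _ _ cc); case: (fC _ (Oh t)).
have L0 : continuous (fun t => f (c1 t, c2 t) * k t).
  have := L 0; under eq_fun do rewrite !mul0r !addr0.
  by apply=> t; rewrite !mul0r !addr0; exact: O0.
pose g_ h t := h^-1 * (f (c1 t + h * a1 t, c2 t + h * a2 t) * k t - f (c1 t, c2 t) * k t).
have E : \forall h \near (0 : R)^', circle_int (g_ h) =
    h^-1 * (circle_int (fun t => f (c1 t + h * a1 t, c2 t + h * a2 t) * k t)
          - circle_int (fun t => f (c1 t, c2 t) * k t)).
  apply: (@cvg_within _ (nbhs (0 : R))); apply: filterS nO => h /L Lh.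
  rewrite /g_ circle_intZ; last by move=> t; apply: cvgB; [exact: Lh|exact: L0].
  by rewrite circle_intB.
apply: cvg_trans (near_eq_cvg E) _.
apply: circle_int_cvg.
- apply: (@cvg_within _ (nbhs (0 : R))); apply: filterS nO => h /L Lh t.
  apply: cvgM; first exact: cvg_cst.
  by apply: cvgB; [exact: Lh|exact: L0].
- move=> t.
  have cc : (c1 t', c2 t') @[t' --> t] --> (c1 t, c2 t).
    by apply: cvg_pair2; [exact: c1c|exact: c2c].
  have [_ _ _ cx cy] := fC _ (O0 t).
  apply: cvgM; last exact: kc.
  apply: cvgD.
    by apply: cvgM; [exact: a1c|exact: (cvg_comp _ _ cc cx)].
  by apply: cvgM; [exact: a2c|exact: (cvg_comp _ _ cc cy)].
- move=> t; set z := (c1 t, c2 t).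
  have nOz : \forall w \near z, Omega w.
    by apply: open_nbhs_nbhs; split; [exact: oO|exact: O0].
  have [_ _ _ cx cy] := fC _ (O0 t).
  have sx : slope f ex z p @[p --> (z, 0)] --> 'D_ex f z.
    by apply: slope_cvg; [apply: filterS nOz => w /fC[dx dy _ _ _]; exact: dx|exact: cx].
  have sy : slope f ey z p @[p --> (z, 0)] --> 'D_ey f z.
    by apply: slope_cvg; [apply: filterS nOz => w /fC[dx dy _ _ _]; exact: dy|exact: cy].
  have ct : p.1 @[p --> (t, (0 : R)^')] --> t by exact: cvg_fst.
  have ch : p.2 @[p --> (t, (0 : R)^')] --> (0 : R).
    have c2' : p.2 @[p --> (t, (0 : R)^')] --> (0 : R)^' by exact: cvg_snd.
    have c0 : h @[h --> (0 : R)^'] --> (0 : R) by exact/cvg_within.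
    exact: (cvg_comp _ _ c2' c0).
  have k1 : c1 p.1 @[p --> (t, (0 : R)^')] --> c1 t by exact: (cvg_comp _ _ ct (c1c t)).
  have k2 : c2 p.1 @[p --> (t, (0 : R)^')] --> c2 t by exact: (cvg_comp _ _ ct (c2c t)).
  have b1 : a1 p.1 @[p --> (t, (0 : R)^')] --> a1 t by exact: (cvg_comp _ _ ct (a1c t)).
  have b2 : a2 p.1 @[p --> (t, (0 : R)^')] --> a2 t by exact: (cvg_comp _ _ ct (a2c t)).
  have kk : k p.1 @[p --> (t, (0 : R)^')] --> k t by exact: (cvg_comp _ _ ct (kc t)).
  have hb1 : p.2 * a1 p.1 @[p --> (t, (0 : R)^')] --> (0 : R).
    by rewrite -[X in _ --> X](mul0r (a1 t)); exact: cvgM.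
  have hb2 : p.2 * a2 p.1 @[p --> (t, (0 : R)^')] --> (0 : R).
    by rewrite -[X in _ --> X](mul0r (a2 t)); exact: cvgM.
  have k2' : c2 p.1 + p.2 * a2 p.1 @[p --> (t, (0 : R)^')] --> c2 t.
    by rewrite -[X in _ --> X](addr0 (c2 t)); exact: cvgD.
  have q1 : (c1 p.1, c2 p.1 + p.2 * a2 p.1, p.2 * a1 p.1)
      @[p --> (t, (0 : R)^')] --> (z, 0 : R).
    by apply: cvg_pair2 hb1; apply: cvg_pair2.
  have q2 : (c1 p.1, c2 p.1, p.2 * a2 p.1) @[p --> (t, (0 : R)^')] --> (z, 0 : R).
    by apply: cvg_pair2 hb2; apply: cvg_pair2.
  have s1 : slope f ex z (c1 p.1, c2 p.1 + p.2 * a2 p.1, p.2 * a1 p.1)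
      @[p --> (t, (0 : R)^')] --> 'D_ex f z by exact: (cvg_comp _ _ q1 sx).
  have s2 : slope f ey z (c1 p.1, c2 p.1, p.2 * a2 p.1)
      @[p --> (t, (0 : R)^')] --> 'D_ey f z by exact: (cvg_comp _ _ q2 sy).
  have H : (a1 p.1 * slope f ex z (c1 p.1, c2 p.1 + p.2 * a2 p.1, p.2 * a1 p.1)
      + a2 p.1 * slope f ey z (c1 p.1, c2 p.1, p.2 * a2 p.1)) * k p.1
      @[p --> (t, (0 : R)^')] --> (a1 t * 'D_ex f z + a2 t * 'D_ey f z) * k t.
    by apply: cvgM kk; apply: cvgD; [exact: cvgM b1 s1|exact: cvgM b2 s2].
  apply: cvg_trans H; apply: near_eq_cvg.
  exists (setT, [set h : R | h != 0]) => /=.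
    by split; [exact: filterT|exact: withinT].
  move=> [s h] /= [_ h0]; rewrite /g_ -mulrBl mulrA; congr (_ * _).
  have E1 := slopeE f ex z (c1 s, c2 s + h * a2 s) (h * a1 s).
  have E2 := slopeE f ey z (c1 s, c2 s) (h * a2 s).
  rewrite scale_ex/= in E1; rewrite scale_ey/= in E2.
  apply: (mulfI h0); rewrite mulrA mulfV// mul1r mulrDr !mulrA -E1 -E2.
  by rewrite addrA subrK.
Qed.

End CircleMeans.

(** * Gain of regularity for Cauchy-Riemann pairs *)

Section Regularity.
Variable R : realType.
Implicit Types (Omega : set (plane R)) (f : plane R -> R) (z w : plane R)
  (k : R -> R) (r s t : R).
Local Notation ex := (@e_x R).
Local Notation ey := (@e_y R).

Lemma circ_ball z w (d r s t : R) : ball z d w -> `|s| <= r -> ball z (d + r) (circ w s t).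
Proof.
move=> /plane_ballP[z1 z2] sr; apply/plane_ballP; rewrite /circ/= !opprD !addrA.
have H (c : R) : `|c| <= 1 -> `|s * c| <= r.
  by move=> c1; rewrite normrM (le_trans _ sr)// ler_piMr.
split; rewrite (le_lt_trans (ler_normB _ _))// ltr_leD// H//.
  exact: cos_max.
exact: sin_max.
Qed.

Lemma near_circ Omega z (rho r : R) : ball z rho `<=` Omega -> `|r| < rho ->
  \forall q \near (z, r), forall t, Omega (circ q.1 q.2 t).
Proof.
(* Half of the slack is spent on moving the centre, half on changing the radius. *)
move=> zO rr; pose e := (rho - `|r|) / 2.
have e0 : 0 < e by rewrite divr_gt0// subr_gt0.
have N1 : \forall w \near z, ball z e w by exact: nbhsx_ballx.
have N2 : \forall s \near r, `|s| < `|r| + e.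
  have := @norm_continuous _ R r => /cvgr_lt; apply.
  by rewrite ltrDl.
exists (ball z e, [set s | `|s| < `|r| + e]) => /=; first by split.
move=> [w s] /= [zw sr] t; apply: zO.
have -> : rho = e + (`|r| + e) by rewrite /e; field.
exact: circ_ball zw (ltW sr).
Qed.

Lemma circle_int_radial Omega f k z s : open Omega -> Ck 1 Omega f -> continuous k ->
  (\forall s' \near s, forall t, Omega (circ z s' t)) ->
  is_derive s 1 (fun s' : R => circle_int (fun t => f (circ z s' t) * k t))
    (circle_int (fun t => (cos t * 'D_ex f (circ z s t) + sin t * 'D_ey f (circ z s t)) * k t)).
Proof.
move=> oO fC kc nO; apply/is_derive1P.
have E h t : circ z (h + s) t = (z.1 + s * cos t + h * cos t, z.2 + s * sin t + h * sin t).
  by rewrite /circ; congr pair; ring.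
under eq_fun do under eq_fun do rewrite E.
have := @circle_int_slope_cvg R Omega f k (fun t => z.1 + s * cos t)
  (fun t => z.2 + s * sin t) cos sin oO fC kc.
apply.
- by move=> t; apply: cvgD; [exact: cvg_cst|apply: cvgM; [exact: cvg_cst|exact: continuous_cos]].
- by move=> t; apply: cvgD; [exact: cvg_cst|apply: cvgM; [exact: cvg_cst|exact: continuous_sin]].
- exact: continuous_cos.
- exact: continuous_sin.
- have H : (h + s) @[h --> (0:R)] --> s.
    by rewrite -[X in _ --> X]add0r; apply: cvgD; [exact: cvg_id|exact: cvg_cst].
  have nO' : \forall h \near (0 : R), forall t, Omega (circ z (h + s) t) by exact: (H _ nO).
  by apply: filterS nO' => h Oh t; rewrite -E; exact: Oh.
Qed.

Lemma circle_int_center Omega f k w r (v : plane R) :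
  open Omega -> Ck 1 Omega f -> continuous k ->
  (\forall w' \near w, forall t, Omega (circ w' r t)) ->
  is_derive w v (fun w' => circle_int (fun t => f (circ w' r t) * k t))
    (circle_int (fun t => (v.1 * 'D_ex f (circ w r t) + v.2 * 'D_ey f (circ w r t)) * k t)).
Proof.
move=> oO fC kc nO.
have E (h : R) t : circ (h *: v + w) r t = (w.1 + r * cos t + h * v.1, w.2 + r * sin t + h * v.2).
  by rewrite /circ /= /GRing.scale /=; congr pair; ring.
have H : h^-1 *: (circle_int (fun t => f (circ (h *: v + w) r t) * k t)
          - circle_int (fun t => f (circ w r t) * k t)) @[h --> (0 : R)^'] -->
  circle_int (fun t => (v.1 * 'D_ex f (circ w r t) + v.2 * 'D_ey f (circ w r t)) * k t).
  under eq_fun do under eq_fun do rewrite E.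
  have := @circle_int_slope_cvg R Omega f k (fun t => w.1 + r * cos t)
    (fun t => w.2 + r * sin t) (fun=> v.1) (fun=> v.2) oO fC kc.
  apply.
  - by move=> t; apply: cvgD; [exact: cvg_cst|apply: cvgM; [exact: cvg_cst|exact: continuous_cos]].
  - by move=> t; apply: cvgD; [exact: cvg_cst|apply: cvgM; [exact: cvg_cst|exact: continuous_sin]].
  - by move=> t; exact: cvg_cst.
  - by move=> t; exact: cvg_cst.
  - have H : (h *: v + w) @[h --> (0:R)] --> w.
      rewrite -[X in _ --> X]add0r; apply: cvgD; last exact: cvg_cst.
      rewrite -[X in _ --> X](scale0r v); apply: cvgZr_tmp; exact: cvg_id.
    have nO' : \forall h \near (0 : R), forall t, Omega (circ (h *: v + w) r t) by exact: (H _ nO).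
    by apply: filterS nO' => h Oh t; rewrite -E; exact: Oh.
split; first by rewrite /derivable; apply/cvg_ex; eexists; exact: H.
by rewrite /derive; apply/cvg_lim => //; exact: H.
Qed.

Definition cauchy_riemann Omega (a b : plane R -> R) : Prop :=
  forall z, Omega z -> 'D_ex a z = 'D_ey b z /\ 'D_ey a z = - 'D_ex b z.

Lemma Ck1_continuous Omega f : Ck 1 Omega f -> forall z, Omega z -> {for z, continuous f}.
Proof. by move=> [fc _] z Oz; exact: fc. Qed.

Section MeanValue.
Variables (Omega : set (plane R)) (a b : plane R -> R) (z : plane R) (rho : R).
Hypotheses (oO : open Omega) (aC : Ck 1 Omega a) (bC : Ck 1 Omega b)
  (cr : cauchy_riemann Omega a b) (rho0 : 0 < rho) (zO : ball z rho `<=` Omega).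

Let Ocirc s t : `|s| < rho -> Omega (circ z s t).
Proof.
move=> sr; apply: zO.
have d0 : 0 < rho - `|s| by rewrite subr_gt0.
rewrite -(subrK `|s| rho); apply: circ_ball => //; exact: ballxx.
Qed.

Let nOcirc s : `|s| < rho -> \forall s' \near s, forall t, Omega (circ z s' t).
Proof.
move=> sr.
have : \forall s' \near s, `|s'| < rho.
  have := @norm_continuous _ R s => /cvgr_lt; exact.
by apply: filterS => s' ? t; exact: Ocirc.
Qed.

(** For F = a + i b, J s is the real part of the integral of F (z + s e^(i t)) e^(- i t), and K s is
    the integral of Re F' over the same circle. *)
Let J s := circle_int (fun t => a (circ z s t) * cos t) +
           circle_int (fun t => b (circ z s t) * sin t).
Let K s := circle_int (fun t => 'D_ex a (circ z s t)).

Let cont_circ f s : (forall w, Omega w -> {for w, continuous f}) -> `|s| < rho ->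
  continuous (fun t => f (circ z s t)).
Proof.
move=> fc sr t; exact: (cvg_comp _ _ (@circ_continuous R z s t) (fc _ (Ocirc t sr))).
Qed.

Let acx : forall w, Omega w -> {for w, continuous ('D_ex a)}.
Proof. by move=> w; have /Ck1P := aC => /[apply] -[]. Qed.
Let acy : forall w, Omega w -> {for w, continuous ('D_ey a)}.
Proof. by move=> w; have /Ck1P := aC => /[apply] -[]. Qed.
Let bcx : forall w, Omega w -> {for w, continuous ('D_ex b)}.
Proof. by move=> w; have /Ck1P := bC => /[apply] -[]. Qed.
Let bcy : forall w, Omega w -> {for w, continuous ('D_ey b)}.
Proof. by move=> w; have /Ck1P := bC => /[apply] -[]. Qed.

(** The radial derivative of F e^(- i t) is F' e^(i t) e^(- i t) = F'. *)
Let dJ s : `|s| < rho -> is_derive s 1 J (K s).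
Proof.
move=> sr.
have D1 := circle_int_radial oO aC (@continuous_cos R) (nOcirc sr).
have D2 := circle_int_radial oO bC (@continuous_sin R) (nOcirc sr).
have cax := cont_circ acx sr; have cay := cont_circ acy sr.
have cbx := cont_circ bcx sr; have cby := cont_circ bcy sr.
apply: is_derive_eq (is_deriveD D1 D2) _.
rewrite -circle_intD; first last.
- move=> t; apply: cvgM; last exact: continuous_sin.
  by apply: cvgD; apply: cvgM; [exact: continuous_cos|exact: cbx|exact: continuous_sin|exact: cby].
- move=> t; apply: cvgM; last exact: continuous_cos.
  by apply: cvgD; apply: cvgM; [exact: continuous_cos|exact: cax|exact: continuous_sin|exact: cay].
congr circle_int; apply/funext => t.
have [-> ->] := cr (Ocirc t sr).
have := cos2Dsin2 t; move: ('D_ey b _) ('D_ex b _) (cos t) (sin t) => A B c d cd.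
transitivity (A * (c ^+ 2 + d ^+ 2)); first by ring.
by rewrite cd mulr1.
Qed.

(** The function g below is minus the imaginary part of F e^(- i t). Its angular derivative is the
    integrand of J s - s K s, and g takes the same value at 0 and 2 pi. *)
Let JK s : `|s| < rho -> J s = s * K s.
Proof.
move=> sr.
pose g t := a (circ z s t) * sin t - b (circ z s t) * cos t.
pose dg t := a (circ z s t) * cos t + b (circ z s t) * sin t
   - s * 'D_ex a (circ z s t).
have ca := cont_circ (Ck1_continuous aC) sr; have cb := cont_circ (Ck1_continuous bC) sr.
have cax := cont_circ acx sr.
have cac : continuous (fun t => a (circ z s t) * cos t).
  by move=> t; apply: cvgM; [exact: ca|exact: continuous_cos].
have cbs : continuous (fun t => b (circ z s t) * sin t).
  by move=> t; apply: cvgM; [exact: cb|exact: continuous_sin].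
have csax : continuous (fun t => s * 'D_ex a (circ z s t)).
  by move=> t; apply: cvgM; [exact: cvg_cst|exact: cax].
have cab : continuous (fun t => a (circ z s t) * cos t + b (circ z s t) * sin t).
  by move=> t; apply: cvgD; [exact: cac|exact: cbs].
have cdg : continuous dg by move=> t; apply: cvgB; [exact: cab|exact: csax].
have Dg t : is_derive t (1 : R) g (dg t).
  have D1 : is_derive t (1 : R) (fun t => z.1 + s * cos t) (- (s * sin t)).
    have := is_deriveD (is_derive_cst z.1 t (1 : R)) (is_deriveZ s (is_derive_cos t)).
    by move=> H; apply: is_derive_eq H _; rewrite add0r /GRing.scale/= mulrN.
  have D2 : is_derive t (1 : R) (fun t => z.2 + s * sin t) (s * cos t).
    have := is_deriveD (is_derive_cst z.2 t (1 : R)) (is_deriveZ s (is_derive_sin t)).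
    by move=> H; apply: is_derive_eq H _; rewrite add0r.
  have Da := @is_derive_curve R Omega a (fun t => z.1 + s * cos t)
    (fun t => z.2 + s * sin t) t _ _ oO aC (Ocirc t sr) D1 D2.
  have Db := @is_derive_curve R Omega b (fun t => z.1 + s * cos t)
    (fun t => z.2 + s * sin t) t _ _ oO bC (Ocirc t sr) D1 D2.
  have := is_deriveB (is_deriveM Da (is_derive_sin t)) (is_deriveM Db (is_derive_cos t)).
  move=> H; apply: is_derive_eq H _.
  rewrite /dg -/(circ z s t) /GRing.scale/=.
  have [-> ->] := cr (Ocirc t sr).
  have := cos2Dsin2 t; move: ('D_ey b _) ('D_ex b _) (a _) (b _) (cos t) (sin t) => A B C D c d cd.
  transitivity (C * c + D * d - s * A * (c ^+ 2 + d ^+ 2)); first by ring.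
  by rewrite cd mulr1.
have := circle_int_derive cdg Dg.
rewrite /g /circ cos2pi sin2pi cos0 sin0 !(mulr0, mulr1) subrr.
rewrite /dg circle_intB// circle_intD// circle_intZ//.
by move/subr0_eq.
Qed.

(** From J' = K and J = s K the quotient J / s = K has derivative 0 for s > 0. Hence K r is the
    limit of K at 0, which is 2 pi times the value at the centre. Only first derivatives of a and b
    enter, so the formula can serve to gain a derivative. *)
Lemma circle_mean_derive r : 0 < r < rho ->
  circle_int (fun t => a (circ z r t) * cos t) +
  circle_int (fun t => b (circ z r t) * sin t) = (pi *+ 2) * r * 'D_ex a z.
Proof.
move=> /andP[r0 rr].
rewrite -/(J r) JK ?ger0_norm ?(ltW r0)//.
suff -> : K r = pi *+ 2 * 'D_ex a z by rewrite mulrCA mulrA.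
have Kr s : 0 < s -> s < r -> K s = K r.
  move=> s0 sr.
  pose M (s' : R) := J s' / s'.
  have sb x : s <= x <= r -> 0 < x /\ `|x| < rho.
    move=> /andP[sx xr]; have x0 := lt_le_trans s0 sx.
    by rewrite ger0_norm ?(ltW x0)//; split => //; exact: le_lt_trans rr.
  have DM x : s <= x <= r -> is_derive x (1:R) M 0.
    move=> /sb[x0 xr].
    have DV : is_derive x (1 : R) (fun y : R => y^-1) (- x ^- 2).
      have := @is_deriveV R id x 1 1 (lt0r_neq0 x0) (is_derive_id x 1).
      by rewrite [X in is_derive _ _ _ X]mulr1.
    have := is_deriveM (dJ xr) DV; move=> H; apply: is_derive_eq H _.
    rewrite /GRing.scale/= JK//; field; exact: lt0r_neq0.
  have cM : {within `[s, r], continuous M}.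
    by apply: derivable_within_continuous => x; rewrite in_itv/= => /DM[].
  have [c] := MVT sr (fun x (xi : x \in `]s, r[) => DM x (subset_itv_oo_cc xi)) cM.
  rewrite mul0r => _ /subr0_eq.
  have MK x : s <= x <= r -> M x = K x.
    by move=> /sb[x0 xr]; rewrite /M (JK xr) mulrAC (mulfV (lt0r_neq0 x0)) mul1r.
  rewrite (MK s (introT andP (conj (lexx _) (ltW sr)))).
  by rewrite (MK r (introT andP (conj (ltW sr) (lexx _)))) => ->.
have n0 : `|0 : R| < rho by rewrite normr0.
have cK : K s @[s --> (0 : R)] --> K 0.
  have c1 : continuous (fun _ : R => 1 : R) by move=> t; exact: cvg_cst.
  have H := @circle_int_circ_cvg R Omega ('D_ex a) _ z 0 c1 acx (near_circ zO n0).
  have KE s : K s = circle_int (fun t => 'D_ex a (circ z s t) * 1).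
    by congr circle_int; apply/funext => t; rewrite mulr1.
  have zs : (z, s) @[s --> (0 : R)] --> (z, 0 : R).
    have hc : (fun=> z) s @[s --> (0 : R)] --> z by exact: cvg_cst.
    exact: (cvg_pair2 hc cvg_id).
  have H' := cvg_comp _ _ zs H.
  by rewrite KE; under eq_fun do rewrite KE; exact: H'.
have -> : pi *+ 2 * 'D_ex a z = K 0.
  rewrite /K -circle_int_cst; congr circle_int; apply/funext => t.
  by rewrite /circ !mul0r !addr0; case: (z).
have L1 : K s @[s --> (0 : R)^'+] --> K 0 by exact: cvg_at_right_filter.
have L2 : K s @[s --> (0 : R)^'+] --> K r.
  apply: cvg_near_cst; near=> s; apply: Kr; near: s.
    exact: nbhs_right_gt.
  exact: nbhs_right_lt.
by apply: (cvg_unique _ L2 L1); exact: Rhausdorff.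
Unshelve. all: by end_near. Qed.

End MeanValue.

(** Near z the mean value formula writes the x-derivative of a as an average of a and b over circles
    of a fixed radius. Such an average can be differentiated in its centre because a and b are
    C^1. *)
Lemma cauchy_riemann_Ck1 Omega (a b : plane R -> R) : open Omega ->
  Ck 1 Omega a -> Ck 1 Omega b -> cauchy_riemann Omega a b ->
  Ck 1 Omega ('D_ex a).
Proof.
move=> oO aC bC cr; apply/Ck1P => z Oz.
have /nbhs_ballP[rho /= rho0 zO] : nbhs z Omega by exact: open_nbhs_nbhs.
have r20 : 0 < rho / 2 by rewrite divr_gt0.
(* Centres range over the ball of radius rho / 2 around z; a ball of radius rho / 2 > r around each
   of them still lies in Omega. *)
pose r := rho / 2 / 2.
have r0 : 0 < r by rewrite divr_gt0.
have rr : r < rho / 2 by rewrite /r; lra.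
have rr' : `|r| < rho / 2 by rewrite ger0_norm// ltW.
have wO w : ball z (rho / 2) w -> ball w (rho / 2) `<=` Omega.
  move=> zw w' ww'; apply: zO; rewrite (splitr rho).
  exact: ball_triangle zw ww'.
pose c := ((pi *+ 2) * r)^-1.
pose G v w := c * (circle_int (fun t => 'D_v a (circ w r t) * cos t)
  + circle_int (fun t => 'D_v b (circ w r t) * sin t)).
pose F w := c * (circle_int (fun t => a (circ w r t) * cos t)
  + circle_int (fun t => b (circ w r t) * sin t)).
have FE w : ball z (rho / 2) w -> 'D_ex a w = F w.
  move=> zw; rewrite /F (circle_mean_derive oO aC bC cr r20 (wO w zw)); last by rewrite r0.
  by rewrite mulrA mulVf ?mul1r// gt_eqF// mulr_gt0// twopi_gt0.
have FE' w : ball z (rho / 2) w -> \forall w' \near w, F w' = 'D_ex a w'.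
  move=> zw; have : nbhs w (ball z (rho / 2)) by apply: open_nbhs_nbhs; split => //; exact: ball_open.
  by apply: filterS => w' /FE.
have nO w : ball z (rho / 2) w -> \forall w' \near w, forall t, Omega (circ w' r t).
  move=> zw; have H := near_circ (wO w zw) rr'.
  have zs : (w', r) @[w' --> w] --> (w, r).
    have hc : (fun=> r) w' @[w' --> w] --> r by exact: cvg_cst.
    exact: (cvg_pair2 cvg_id hc).
  exact: (zs _ H).
have DF w v : v = ex \/ v = ey -> ball z (rho / 2) w -> is_derive w v F (G v w).
  move=> vE zw.
  have D1 := circle_int_center v oO aC (@continuous_cos R) (nO w zw).
  have D2 := circle_int_center v oO bC (@continuous_sin R) (nO w zw).
  have := is_deriveZ c (is_deriveD D1 D2); move=> H; apply: is_derive_eq H _.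
  rewrite /G /GRing.scale/=; congr (_ * (_ + _)); congr circle_int; apply/funext => t.
    by case: vE => -> /=; rewrite mul1r mul0r ?addr0 ?add0r.
  by case: vE => -> /=; rewrite mul1r mul0r ?addr0 ?add0r.
have DA w v : v = ex \/ v = ey -> ball z (rho / 2) w -> is_derive w v ('D_ex a) (G v w).
  move=> vE zw; apply: near_eq_is_derive (DF w v vE zw).
  exact: FE'.
have GC v : v = ex \/ v = ey -> {for z, continuous (G v)}.
  move=> vE.
  have zs : (w, r) @[w --> z] --> (z, r).
    have hc : (fun=> r) w @[w --> z] --> r by exact: cvg_cst.
    exact: (cvg_pair2 cvg_id hc).
  have H f (k : R -> R) : continuous k -> Ck 1 Omega f ->
      circle_int (fun t => 'D_v f (circ w r t) * k t) @[w --> z] -->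
      circle_int (fun t => 'D_v f (circ z r t) * k t).
    move=> kc /Ck1P fC.
    have fv w : Omega w -> {for w, continuous ('D_v f)}.
      by move=> /fC[_ _ _ fx fy]; case: vE => ->; [exact: fx|exact: fy].
    exact: (cvg_comp _ _ zs (circle_int_circ_cvg kc fv (near_circ (wO z (ballxx z r20)) rr'))).
  rewrite /prop_for /continuous_at /G; apply: cvgM; first exact: cvg_cst.
  by apply: cvgD; apply: H; [exact: continuous_cos|exact: aC|exact: continuous_sin|exact: bC].
have zz : ball z (rho / 2) z by exact: ballxx.
have cD v : v = ex \/ v = ey -> {for z, continuous ('D_v ('D_ex a))}.
  move=> vE.
  have E : \forall w \near z, G v w = 'D_v ('D_ex a) w.
    have : nbhs z (ball z (rho / 2)) by exact: nbhsx_ballx.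
    by apply: filterS => w /(DA w v vE) [].
  rewrite /prop_for /continuous_at -(nbhs_singleton E).
  exact: cvg_trans (near_eq_cvg E) (GC v vE).
have [_ _ _ cax _] := (Ck1P Omega a).1 aC z Oz.
split.
- by case: (DA z ex (or_introl erefl) zz).
- by case: (DA z ey (or_intror erefl) zz).
- exact: cax.
- exact: cD (or_introl erefl).
- exact: cD (or_intror erefl).
Qed.

End Regularity.

(** * Wirtinger calculus *)

Section Wirtinger.
Variable R : realType.
Local Notation C := R[i].
Implicit Types (Omega : set (plane R)) (z w v : plane R) (F G : plane R -> C) (a b c d : C).
Local Notation ex := (@e_x R).
Local Notation ey := (@e_y R).

Lemma ReM (x y : C) : complex.Re (x * y) =
  complex.Re x * complex.Re y - complex.Im x * complex.Im y.
Proof. by case: x y => [? ?] [? ?]. Qed.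
Lemma ImM (x y : C) : complex.Im (x * y) =
  complex.Re x * complex.Im y + complex.Im x * complex.Re y.
Proof. by case: x y => [? ?] [? ?]. Qed.
Lemma ReD (x y : C) : complex.Re (x + y) = complex.Re x + complex.Re y.
Proof. by case: x y => [? ?] [? ?]. Qed.
Lemma ImD (x y : C) : complex.Im (x + y) = complex.Im x + complex.Im y.
Proof. by case: x y => [? ?] [? ?]. Qed.
Lemma ReJ (x : C) : complex.Re (conjc x) = complex.Re x.
Proof. by case: x. Qed.
Lemma ImJ (x : C) : complex.Im (conjc x) = - complex.Im x.
Proof. by case: x. Qed.
Lemma complex_eqP (x y : C) : complex.Re x = complex.Re y ->
  complex.Im x = complex.Im y -> x = y.
Proof. by case: x y => [? ?] [? ?] /= -> ->. Qed.

(** Taken componentwise, so that the calculus of real directional derivatives applies directly. *)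
Definition derivC v F z d : Prop :=
  is_derive z v (fun w => complex.Re (F w)) (complex.Re d) /\
  is_derive z v (fun w => complex.Im (F w)) (complex.Im d).

Definition contC F z : Prop :=
  {for z, continuous (fun w => complex.Re (F w))} /\
  {for z, continuous (fun w => complex.Im (F w))}.

(* [wirtinger F z a b]: F is continuous at z and has partial derivatives there,
   with dF/dz = a and dF/d(conj z) = b. *)
Definition wirtinger F z a b : Prop :=
  [/\ contC F z, derivC ex F z (a + b) & derivC ey F z ('i%C * (a - b))].

Definition cplane z : C := (z.1 +i* z.2)%C.

Lemma derivC_unique v F z c d : derivC v F z c -> derivC v F z d -> c = d.
Proof.
move=> [[_ e1] [_ e2]] [[_ e3] [_ e4]].
by apply: complex_eqP; [rewrite -e1 e3|rewrite -e2 e4].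
Qed.

Lemma two_neq0 : (2 : C) != 0. Proof. by rewrite pnatr_eq0. Qed.

(** With [wirtinger_near] this is the device for differentiating identities: when two expressions
    agree near z, the coefficients computed for each by the calculus rules must agree. *)
Lemma wirtinger_unique F z a b a' b' :
  wirtinger F z a b -> wirtinger F z a' b' -> a = a' /\ b = b'.
Proof.
move=> [_ x y] [_ x' y'].
have E1 := derivC_unique x x'; have E2 := derivC_unique y y'.
have i0 : ('i%C : C) != 0 by rewrite eq_complex /= oner_eq0 andbF.
move/(mulfI i0) in E2.
split; apply: (mulfI two_neq0).
  by transitivity ((a + b) + (a - b)); [ring|rewrite E1 E2; ring].
by transitivity ((a + b) - (a - b)); [ring|rewrite E1 E2; ring].
Qed.

Lemma derivC_near v F G z d : (\forall w \near z, F w = G w) ->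
  derivC v F z d -> derivC v G z d.
Proof.
move=> FG [x y]; split.
  by apply: near_eq_is_derive x; apply: filterS FG => w ->.
by apply: near_eq_is_derive y; apply: filterS FG => w ->.
Qed.

Lemma contC_near F G z : (\forall w \near z, F w = G w) -> contC F z -> contC G z.
Proof.
move=> FG [x y].
have E := nbhs_singleton FG.
split; rewrite /prop_for /continuous_at -E.
  by apply: cvg_trans x; apply: near_eq_cvg; apply: filterS FG => w ->.
by apply: cvg_trans y; apply: near_eq_cvg; apply: filterS FG => w ->.
Qed.

Lemma wirtinger_near F G z a b : (\forall w \near z, F w = G w) ->
  wirtinger F z a b -> wirtinger G z a b.
Proof.
move=> FG [c x y]; split; [exact: contC_near c|exact: derivC_near x|exact: derivC_near y].
Qed.

Lemma derivC_cst v c z : derivC v (fun=> c) z 0.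
Proof. by split; exact: is_derive_cst. Qed.

Lemma derivCD v F G z c d : derivC v F z c -> derivC v G z d ->
  derivC v (fun w => F w + G w) z (c + d).
Proof.
move=> [x y] [x' y']; split.
  under eq_fun do rewrite ReD; rewrite ReD; exact: is_deriveD.
under eq_fun do rewrite ImD; rewrite ImD; exact: is_deriveD.
Qed.

Lemma derivCM v F G z c d : derivC v F z c -> derivC v G z d ->
  derivC v (fun w => F w * G w) z (c * G z + F z * d).
Proof.
move=> [x y] [x' y']; split.
  under eq_fun do rewrite ReM.
  apply: is_derive_eq (is_deriveB (is_deriveM x x') (is_deriveM y y')) _.
  by rewrite /GRing.scale/= ReD !ReM; ring.
under eq_fun do rewrite ImM.
apply: is_derive_eq (is_deriveD (is_deriveM x y') (is_deriveM y x')) _.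
by rewrite /GRing.scale/= ImD !ImM; ring.
Qed.

Lemma derivCJ v F z c : derivC v F z c -> derivC v (fun w => conjc (F w)) z (conjc c).
Proof.
move=> [x y]; split.
  by under eq_fun do rewrite ReJ; rewrite ReJ.
by under eq_fun do rewrite ImJ; rewrite ImJ; exact: is_deriveN.
Qed.

Lemma contC_cst c z : contC (fun=> c) z.
Proof. by split; exact: cvg_cst. Qed.

Lemma contCD F G z : contC F z -> contC G z -> contC (fun w => F w + G w) z.
Proof.
move=> [x y] [x' y']; split; rewrite /prop_for /continuous_at.
  by under eq_fun do rewrite ReD; rewrite ReD; exact: cvgD.
by under eq_fun do rewrite ImD; rewrite ImD; exact: cvgD.
Qed.

Lemma contCM F G z : contC F z -> contC G z -> contC (fun w => F w * G w) z.
Proof.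
move=> [x y] [x' y']; split; rewrite /prop_for /continuous_at.
  by under eq_fun do rewrite ReM; rewrite ReM; apply: cvgB; exact: cvgM.
by under eq_fun do rewrite ImM; rewrite ImM; apply: cvgD; exact: cvgM.
Qed.

Lemma contCJ F z : contC F z -> contC (fun w => conjc (F w)) z.
Proof.
move=> [x y]; split; rewrite /prop_for /continuous_at.
  by under eq_fun do rewrite ReJ; rewrite ReJ.
by under eq_fun do rewrite ImJ; rewrite ImJ; exact: cvgN.
Qed.

Lemma wirtinger_cst c z : wirtinger (fun=> c) z 0 0.
Proof.
split; first exact: contC_cst.
  by rewrite addr0; exact: derivC_cst.
by rewrite subr0 mulr0; exact: derivC_cst.
Qed.

Lemma wirtingerD F G z a b c d : wirtinger F z a b -> wirtinger G z c d ->
  wirtinger (fun w => F w + G w) z (a + c) (b + d).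
Proof.
move=> [k x y] [k' x' y']; split; first exact: contCD.
  by rewrite addrACA; exact: derivCD.
by rewrite opprD addrACA mulrDr; exact: derivCD.
Qed.

Lemma wirtingerM F G z a b c d : wirtinger F z a b -> wirtinger G z c d ->
  wirtinger (fun w => F w * G w) z (a * G z + F z * c) (b * G z + F z * d).
Proof.
move=> [k x y] [k' x' y']; split; first exact: contCM.
  have := derivCM x x'; congr derivC; ring.
have := derivCM y y'; congr derivC; ring.
Qed.

Lemma wirtingerN F z a b : wirtinger F z a b -> wirtinger (fun w => - F w) z (- a) (- b).
Proof.
move=> H; have := wirtingerM (wirtinger_cst (-1) z) H.
rewrite !mul0r !add0r !mulN1r.
by have -> : (fun w => -1 * F w) = (fun w => - F w)
  by apply/funext => w; rewrite mulN1r.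
Qed.

Lemma wirtingerB F G z a b c d : wirtinger F z a b -> wirtinger G z c d ->
  wirtinger (fun w => F w - G w) z (a - c) (b - d).
Proof. by move=> H1 H2; exact: wirtingerD H1 (wirtingerN H2). Qed.

Lemma wirtingerX F z a b : wirtinger F z a b ->
  wirtinger (fun w => F w ^+ 2) z (2 * F z * a) (2 * F z * b).
Proof.
move=> H; have := wirtingerM H H.
rewrite (_ : a * F z + F z * a = 2 * F z * a); last by ring.
by rewrite (_ : b * F z + F z * b = 2 * F z * b); last by ring.
Qed.

Lemma conjc_iM (x : C) : conjc ('i%C * x) = - 'i%C * conjc x.
Proof. by case: x => x y; apply: complex_eqP => /=; ring. Qed.

Lemma wirtingerJ F z a b : wirtinger F z a b ->
  wirtinger (fun w => conjc (F w)) z (conjc b) (conjc a).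
Proof.
move=> [k x y]; split; first exact: contCJ.
  have := derivCJ x; congr derivC; by rewrite rmorphD addrC.
have := derivCJ y; congr derivC; rewrite conjc_iM rmorphB; ring.
Qed.

Lemma contC_cplane z : contC cplane z.
Proof.
split.
  have H : (fun w : plane R => w.1) w @[w --> z] --> z.1.
    by case: (z) => x y; exact: (@cvg_fst _ _ (nbhs x) (nbhs y) _).
  exact: H.
have H : (fun w : plane R => w.2) w @[w --> z] --> z.2.
  by case: (z) => x y; exact: (@cvg_snd _ _ (nbhs x) (nbhs y) _).
exact: H.
Qed.

Lemma wirtinger_cplane z : wirtinger cplane z 1 0.
Proof.
split.
- exact: contC_cplane.
- split; apply: is_derive_affine => h; rewrite scale_ex /=; ring.
- split; apply: is_derive_affine => h; rewrite scale_ey /=; ring.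
Qed.

Lemma is_derive_inv (f : plane R -> R) z v (d : R) : f z != 0 -> is_derive z v f d ->
  is_derive z v (fun w => (f w)^-1) (- (f z) ^- 2 * d).
Proof.
by move=> f0 [fd <-]; split; [exact: derivableV|rewrite deriveV].
Qed.

Lemma invcE (x : C) : x^-1 =
  ((complex.Re x * (complex.Re x ^+ 2 + complex.Im x ^+ 2)^-1) +i*
   (- (complex.Im x * (complex.Re x ^+ 2 + complex.Im x ^+ 2)^-1)))%C.
Proof. by case: x. Qed.

Lemma sqr_normC_neq0 (x : C) : x != 0 -> complex.Re x ^+ 2 + complex.Im x ^+ 2 != 0.
Proof.
case: x => r s; rewrite eq_complex /=; apply: contraNN.
by rewrite paddr_eq0 ?sqr_ge0// !sqrf_eq0.
Qed.

(** Differentiating F G = 1 gives the value of the derivative of G once it is known to exist. For G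
    = 1 / F existence comes from the real formula [invcE], and the real quotients never have to be
    simplified. *)
Lemma derivC_unit v F G z : (\forall w \near z, F w * G w = 1) ->
  F z != 0 -> (exists d, derivC v G z d) -> forall c, derivC v F z c ->
  derivC v G z (- c / F z ^+ 2).
Proof.
move=> FG F0 [d Gd] c Fc.
have := derivCM Fc Gd => H.
have := derivC_unique (derivC_near FG H) (derivC_cst v 1 z) => E.
suff <- : d = - c / F z ^+ 2 by [].
have GE : G z = (F z)^-1.
  by apply: (mulfI F0); rewrite (nbhs_singleton FG) mulfV.
move: E; rewrite GE => E.
apply: (mulfI F0); rewrite -[LHS](addKr (c / F z)) E addr0; field.
exact: F0.
Qed.

Lemma contCV F z : contC F z -> F z != 0 -> contC (fun w => (F w)^-1) z.
Proof.
move=> [x y] F0.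
pose n2 w := complex.Re (F w) ^+ 2 + complex.Im (F w) ^+ 2.
have cn : {for z, continuous n2}.
  by rewrite /prop_for /continuous_at; apply: cvgD; apply: cvgM.
have cV : (n2 w)^-1 @[w --> z] --> (n2 z)^-1.
  by apply: cvgV => //; exact: sqr_normC_neq0.
split; rewrite /prop_for /continuous_at.
  by under eq_fun do rewrite invcE; rewrite invcE; exact: cvgM.
by under eq_fun do rewrite invcE; rewrite invcE; apply: cvgN; exact: cvgM.
Qed.

Lemma contC_neq0 F z : contC F z -> F z != 0 -> \forall w \near z, F w != 0.
Proof.
move=> [x y] F0.
pose n2 w := complex.Re (F w) ^+ 2 + complex.Im (F w) ^+ 2.
have cn : n2 w @[w --> z] --> n2 z by apply: cvgD; apply: cvgM.
have np : 0 < n2 z.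
  by rewrite lt_neqAle eq_sym sqr_normC_neq0// addr_ge0// sqr_ge0.
have N : \forall w \near z, 0 < n2 w by exact: (cvgr_gt _ cn _ np).
apply: filterS N => w; rewrite /n2; apply: contraTneq => ->.
by rewrite /= expr0n /= addr0 ltxx.
Qed.

Lemma derivCV v F z c : contC F z -> derivC v F z c -> F z != 0 ->
  derivC v (fun w => (F w)^-1) z (- c / F z ^+ 2).
Proof.
move=> cF Fc F0.
pose n2 w := complex.Re (F w) ^+ 2 + complex.Im (F w) ^+ 2.
have n0 : n2 z != 0 by exact: sqr_normC_neq0.
apply: derivC_unit (Fc) => //.
- by apply: filterS (contC_neq0 cF F0) => w Fw; rewrite mulfV.
- have [x y] := Fc.
  have Dn := is_deriveD (is_deriveM x x) (is_deriveM y y).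
  have DV := is_derive_inv n0 Dn.
  eexists (Complex _ _); split => /=.
    under eq_fun do rewrite invcE /=; exact: is_deriveM x DV.
  under eq_fun do rewrite invcE /=; exact: is_deriveN (is_deriveM y DV).
Qed.

Lemma wirtingerV F z a : wirtinger F z a 0 -> F z != 0 ->
  wirtinger (fun w => (F w)^-1) z (- a / F z ^+ 2) 0.
Proof.
move=> [cF x y] F0; split; first exact: contCV.
  have := derivCV cF x F0; congr derivC; ring.
have := derivCV cF y F0; congr derivC; ring.
Qed.

End Wirtinger.

(** * Holomorphic functions as C^1 Cauchy-Riemann pairs *)

Section Holomorphic.
Variable R : realType.
Local Notation C := R[i].
Implicit Types (Omega : set (plane R)) (z w : plane R) (F G : plane R -> C) (a b c d : C).
Local Notation ex := (@e_x R).
Local Notation ey := (@e_y R).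

Definition holomorphic Omega F : Prop :=
  [/\ Ck 1 Omega (fun w => complex.Re (F w)), Ck 1 Omega (fun w => complex.Im (F w)) &
      cauchy_riemann Omega (fun w => complex.Re (F w)) (fun w => complex.Im (F w))].

(** For holomorphic F the complex derivative is the derivative along the real axis. *)
Definition dz F z : C :=
  ('D_ex (fun w => complex.Re (F w)) z +i* 'D_ex (fun w => complex.Im (F w)) z)%C.

Lemma continuous_near (f g : plane R -> R) z : (\forall w \near z, f w = g w) ->
  {for z, continuous f} -> {for z, continuous g}.
Proof.
move=> fg cf; rewrite /prop_for /continuous_at -(nbhs_singleton fg).
exact: cvg_trans (near_eq_cvg fg) cf.
Qed.

Lemma Ck1_near Omega (f g : plane R -> R) : open Omega ->
  (forall w, Omega w -> f w = g w) -> Ck 1 Omega f -> Ck 1 Omega g.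
Proof.
move=> oO fg /Ck1P fC; apply/Ck1P => z Oz.
have nfg w : Omega w -> \forall w' \near w, f w' = g w'.
  move=> Ow; have nO : \forall w' \near w, Omega w' by apply: open_nbhs_nbhs.
  by apply: filterS nO.
have [dx dy cf cx cy] := fC z Oz.
have nO : \forall w \near z, Omega w by apply: open_nbhs_nbhs.
split.
- exact: near_eq_derivable (nfg z Oz) dx.
- exact: near_eq_derivable (nfg z Oz) dy.
- exact: continuous_near (nfg z Oz) cf.
- by apply: continuous_near cx; apply: filterS nO => w Ow; apply: near_eq_derive; exact: nfg.
- by apply: continuous_near cy; apply: filterS nO => w Ow; apply: near_eq_derive; exact: nfg.
Qed.

Lemma Ck1Z Omega (c : R) (f : plane R -> R) : open Omega -> Ck 1 Omega f ->
  Ck 1 Omega (fun w => c * f w).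
Proof.
move=> oO /Ck1P fC.
have DZ w v : derivable f w v -> is_derive w v (fun w => c * f w) (c * 'D_v f w).
  by move=> fw; apply: is_deriveZ; exact: derivableP.
apply/Ck1P => z Oz; have [dx dy cf cx cy] := fC z Oz.
have nO : \forall w \near z, Omega w by apply: open_nbhs_nbhs.
have N v : (forall w, Omega w -> derivable f w v) ->
    \forall w \near z, c * 'D_v f w = 'D_v (fun w => c * f w) w.
  by move=> fd; apply: filterS nO => w /fd /DZ [].
split.
- by case: (DZ z _ dx).
- by case: (DZ z _ dy).
- by apply: cvgM cf; exact: cvg_cst.
- apply: continuous_near (N ex _) _; last by apply: cvgM cx; exact: cvg_cst.
  by move=> w /fC[wx _ _ _ _]; exact: wx.
- apply: continuous_near (N ey _) _; last by apply: cvgM cy; exact: cvg_cst.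
  by move=> w /fC[_ wy _ _ _]; exact: wy.
Qed.

Lemma Ck1N Omega (f : plane R -> R) : open Omega -> Ck 1 Omega f ->
  Ck 1 Omega (fun w => - f w).
Proof.
move=> oO fC; have -> : (fun w => - f w) = (fun w => -1 * f w).
  by apply/funext => w; rewrite mulN1r.
exact: Ck1Z.
Qed.

(** The new pair consists of the real and imaginary parts of - i (a + i b), so what is proved for
    the real part carries over to the imaginary part. *)
Lemma cauchy_riemann_conj Omega (a b : plane R -> R) : Ck 1 Omega a ->
  cauchy_riemann Omega a b -> cauchy_riemann Omega b (fun w => - a w).
Proof.
move=> /Ck1P aC cr z Oz; have [e1 e2] := cr z Oz; have [dx dy _ _ _] := aC z Oz.
have -> : 'D_ex (fun w => - a w) z = - 'D_ex a z by exact: deriveN dx.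
have -> : 'D_ey (fun w => - a w) z = - 'D_ey a z by exact: deriveN dy.
by rewrite opprK -e1; split; [rewrite e2 opprK|].
Qed.

Lemma holomorphic_wirtinger Omega F z : holomorphic Omega F -> Omega z ->
  wirtinger F z (dz F z) 0.
Proof.
move=> [/Ck1P aC /Ck1P bC cr] Oz.
have [ax ay ac _ _] := aC z Oz; have [bx by_ bc _ _] := bC z Oz.
have [e1 e2] := cr z Oz.
split; first by split; [exact: ac|exact: bc].
  by rewrite addr0; split; apply: derivableP; [exact: ax|exact: bx].
rewrite subr0; split.
  by rewrite ReM /= mul0r mul1r sub0r -e2; apply: derivableP; exact: ay.
by rewrite ImM /= mul0r mul1r add0r e1; apply: derivableP; exact: by_.
Qed.

(** The x-derivatives of both parts are C^1 by circle means, the y-derivatives then by the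
    Cauchy-Riemann equations. Both parts are therefore C^2, and the symmetry of mixed derivatives
    turns the x-derivative of the Cauchy-Riemann equations into those of F'. *)
Lemma holomorphic_dz Omega F : open Omega -> holomorphic Omega F -> holomorphic Omega (dz F).
Proof.
move=> oO [aC bC cr].
set a := fun w => complex.Re (F w); set b := fun w => complex.Im (F w).
have ax : Ck 1 Omega ('D_ex a) := cauchy_riemann_Ck1 oO aC bC cr.
have bx : Ck 1 Omega ('D_ex b).
  exact: cauchy_riemann_Ck1 oO bC (Ck1N oO aC) (cauchy_riemann_conj aC cr).
have by_ : Ck 1 Omega ('D_ey b) by apply: Ck1_near ax => // w /cr[].
have ay : Ck 1 Omega ('D_ey a).
  by apply: Ck1_near (Ck1N oO bx) => // w /cr[_ ->].
have a2 : Ck 2 Omega a by apply/Ck2P; split; [exact: aC|exact: ax|exact: ay].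
have b2 : Ck 2 Omega b by apply/Ck2P; split; [exact: bC|exact: bx|exact: by_].
split; [exact: ax|exact: bx|] => z Oz.
have nO : \forall w \near z, Omega w by apply: open_nbhs_nbhs.
have /Ck1P := bx => /(_ z Oz)[bxx _ _ _ _].
rewrite -/a -/b; split.
  rewrite -(Ck2_symmetric oO b2 Oz); apply: near_eq_derive.
  by apply: filterS nO => w /cr[].
rewrite -(Ck2_symmetric oO a2 Oz) -(deriveN bxx); apply: near_eq_derive.
by apply: filterS nO => w /cr[].
Qed.

Lemma holomorphic_contC Omega F z : holomorphic Omega F -> Omega z -> contC F z.
Proof. by move=> H Oz; have [] := holomorphic_wirtinger H Oz. Qed.

Lemma wirtinger0_derive F z : wirtinger F z 0 0 ->
  [/\ derivable (fun w => complex.Re (F w)) z ex, derivable (fun w => complex.Re (F w)) z ey,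
     'D_ex (fun w => complex.Re (F w)) z = 0 & 'D_ey (fun w => complex.Re (F w)) z = 0] /\
  [/\ derivable (fun w => complex.Im (F w)) z ex, derivable (fun w => complex.Im (F w)) z ey,
     'D_ex (fun w => complex.Im (F w)) z = 0 & 'D_ey (fun w => complex.Im (F w)) z = 0].
Proof.
move=> [_ []]; rewrite addr0 subr0 mulr0 => -[xd x0] [xd' x0'] [[yd y0] [yd' y0']].
by split; split.
Qed.

Lemma ball_constantC F z (e : R) :
  (forall w, ball z e w -> wirtinger F w 0 0) -> forall w, ball z e w -> F w = F z.
Proof.
move=> H w zw; apply: complex_eqP.
  by apply: (@ball_constant R z e (fun w => complex.Re (F w)) _ w zw) => w' /H/wirtinger0_derive[].
by apply: (@ball_constant R z e (fun w => complex.Im (F w)) _ w zw) => w' /H/wirtinger0_derive[].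
Qed.

Lemma domain_constantC Omega F : domain Omega ->
  (forall w, Omega w -> wirtinger F w 0 0) -> exists c, forall z, Omega z -> F z = c.
Proof.
move=> dO H.
have [c1 e1] : exists c : R, forall z, Omega z -> complex.Re (F z) = c.
  by apply: domain_constant => // w /H/wirtinger0_derive[].
have [c2 e2] : exists c : R, forall z, Omega z -> complex.Im (F z) = c.
  by apply: domain_constant => // w /H/wirtinger0_derive[].
by exists (c1 +i* c2)%C => z Oz; apply: complex_eqP; [exact: e1|exact: e2].
Qed.

End Holomorphic.

(** * Holomorphic functions satisfying the ruling equation *)

Section Classification.
Variable R : realType.
Local Notation C := R[i].
Local Notation Z := (@cplane R).
Variables (Omega : set (plane R)) (phi : plane R -> C).
Hypotheses (oO : open Omega) (cO : connected Omega) (hphi : holomorphic Omega phi).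
Implicit Types (z w : plane R).

(** Q is the conjugate of P. The two are kept apart because their derivatives in (z, conj z) differ:
    (1, conj phi') for P and (phi', 1) for Q. *)
Let P z := Z z + conjc (phi z).
Let Q z := conjc (Z z) + phi z.
Let phi1 := dz phi.
Let phi2 := dz phi1.
Let phi3 := dz phi2.

Hypothesis ruled : forall z, Omega z ->
  P z ^+ 2 * phi1 z = Q z ^+ 2 * conjc (phi1 z).

Let h1 : holomorphic Omega phi1 := holomorphic_dz oO hphi.
Let h2 : holomorphic Omega phi2 := holomorphic_dz oO h1.
Let h3 : holomorphic Omega phi3 := holomorphic_dz oO h2.

Let nearO z : Omega z -> \forall w \near z, Omega w.
Proof. by move=> Oz; apply: open_nbhs_nbhs. Qed.

Let w0 z : Omega z -> wirtinger phi z (phi1 z) 0 := holomorphic_wirtinger hphi.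
Let w1 z : Omega z -> wirtinger phi1 z (phi2 z) 0 := holomorphic_wirtinger h1.
Let w2 z : Omega z -> wirtinger phi2 z (phi3 z) 0 := holomorphic_wirtinger h2.

Let wP z : Omega z -> wirtinger P z 1 (conjc (phi1 z)).
Proof.
move=> Oz; have := wirtingerD (wirtinger_cplane z) (wirtingerJ (w0 Oz)).
by rewrite rmorph0 addr0 add0r.
Qed.

Let wQ z : Omega z -> wirtinger Q z (phi1 z) 1.
Proof.
move=> Oz; have := wirtingerD (wirtingerJ (wirtinger_cplane z)) (w0 Oz).
by rewrite rmorph0 rmorph1 addr0 add0r.
Qed.

Let wJ1 z : Omega z -> wirtinger (fun w => conjc (phi1 w)) z 0 (conjc (phi2 z)).
Proof. by move=> Oz; have := wirtingerJ (w1 Oz); rewrite rmorph0. Qed.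

Lemma ruled_dz z : Omega z ->
  P z ^+ 2 * phi2 z = 2 * Q z * phi1 z * conjc (phi1 z) - 2 * P z * phi1 z.
Proof.
move=> Oz.
have W1 := wirtingerM (wirtingerX (wP Oz)) (w1 Oz).
have W2 := wirtingerM (wirtingerX (wQ Oz)) (wJ1 Oz).
have N : \forall w \near z, Q w ^+ 2 * conjc (phi1 w) = P w ^+ 2 * phi1 w.
  by apply: filterS (nearO Oz) => w Ow; rewrite ruled.
have W3 := wirtinger_near N W2.
have [E _] := wirtinger_unique W1 W3.
move: E; rewrite !mulr1 mulr0 addr0 => E.
apply: (addrI (2 * P z * phi1 z)); rewrite E; ring.
Qed.

Lemma ruled_dzz z : Omega z ->
  P z ^+ 2 * phi3 z = - 2 * phi1 z - 4 * P z * phi2 z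
    + 2 * phi1 z ^+ 2 * conjc (phi1 z) + 2 * Q z * phi2 z * conjc (phi1 z).
Proof.
move=> Oz.
have W1 := wirtingerM (wirtingerX (wP Oz)) (w2 Oz).
have W2 := wirtingerB
  (wirtingerM (wirtingerM (wirtingerM (wirtinger_cst 2 z) (wQ Oz)) (w1 Oz)) (wJ1 Oz))
  (wirtingerM (wirtingerM (wirtinger_cst 2 z) (wP Oz)) (w1 Oz)).
have N : \forall w \near z, 2 * Q w * phi1 w * conjc (phi1 w) - 2 * P w * phi1 w =
    P w ^+ 2 * phi2 w.
  by apply: filterS (nearO Oz) => w Ow; rewrite ruled_dz.
have W3 := wirtinger_near N W2.
have [E _] := wirtinger_unique W1 W3.
apply: (addrI (2 * P z * 1 * phi2 z)); rewrite E; ring.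
Qed.

(** If H z were nonzero, Q would vanish near z; but its derivative in conj z is 1. *)
Lemma Q_neq0_dense (H : plane R -> C) z : (forall w, Omega w -> contC H w) ->
  (forall w, Omega w -> Q w != 0 -> H w = 0) -> Omega z -> H z = 0.
Proof.
move=> cH H0 Oz; apply/eqP; apply: contraT => Hz.
have nH := contC_neq0 (cH z Oz) Hz.
have W : wirtinger (fun=> 0) z (phi1 z) 1.
  apply: wirtinger_near (wQ Oz).
  apply: filterS (filterI nH (nearO Oz)) => w [Hw Ow].
  by apply/eqP; apply: contraNT Hw => Qw; apply/eqP; exact: H0.
have [_ /eqP] := wirtinger_unique W (wirtinger_cst 0 z).
by rewrite oner_eq0.
Qed.

Lemma conjc_Q z : conjc (Q z) = P z.
Proof.
rewrite /Q /P; move: (Z z) (phi z) => [a b] [c d].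
by apply: complex_eqP => /=; ring.
Qed.

Lemma P_neq0 z : Q z != 0 -> P z != 0.
Proof. by rewrite -conjc_Q conjc_eq0. Qed.

Lemma schwarzian0 z : Omega z -> 2 * phi1 z * phi3 z = 3 * phi2 z ^+ 2.
Proof.
move=> Oz; apply: subr0_eq.
apply: (@Q_neq0_dense (fun z => 2 * phi1 z * phi3 z - 3 * phi2 z ^+ 2)) Oz => w Ow.
  have c1 := holomorphic_contC h1 Ow; have c2 := holomorphic_contC h2 Ow.
  have c3 := holomorphic_contC h3 Ow.
  apply: contCD; first by apply: contCM => //; apply: contCM => //; exact: contC_cst.
  have -> : (fun w => - (3 * phi2 w ^+ 2)) = (fun w => (- 3) * (phi2 w * phi2 w)).
    by apply/funext => x; ring.
  by apply: contCM; [exact: contC_cst|exact: contCM].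
move=> /P_neq0 Pw.
have e0 := ruled Ow; have e1 := ruled_dz Ow; have e2 := ruled_dzz Ow.
(* The factor P^4 lets the claim be written through P^2 phi''', P^2 phi'' and P^2 phi', which are
   then replaced in this order by means of the three relations. *)
apply: (mulfI (expf_neq0 4 Pw)); rewrite mulr0.
move: (P w) (Q w) (phi1 w) (conjc (phi1 w)) (phi2 w) (phi3 w) e0 e1 e2 {Pw Ow}.
move=> p q a a' b c e0 e1 e2.
have -> : p ^+ 4 * (2 * a * c - 3 * b ^+ 2) =
  2 * a * p ^+ 2 * (p ^+ 2 * c) - 3 * (p ^+ 2 * b) ^+ 2 by ring.
rewrite e2.
have -> : 2 * a * p ^+ 2 * (- 2 * a - 4 * p * b + 2 * a ^+ 2 * a' + 2 * q * b * a') =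
  - 4 * a ^+ 2 * p ^+ 2 + 4 * a ^+ 2 * a' * (p ^+ 2 * a)
  + (4 * a * q * a' - 8 * a * p) * (p ^+ 2 * b) by ring.
rewrite e1 e0; ring.
Qed.

(** A vanishing Schwarzian means that phi'^(- 1/2) is affine; working with its square avoids the
    choice of a root. N0 is twice the second derivative of 1 / phi', with phi''' eliminated, and N1,
    N2 are the remaining coefficients of 4 / phi'. The relation N0 N2 = N1^2 records that this
    quadratic is a square. *)
Let N0 z := phi2 z ^+ 2 * (phi1 z ^+ 2 * phi1 z)^-1.
Let N1 z := (phi2 z ^+ 2 * Z z + 2 * phi1 z * phi2 z) * (phi1 z ^+ 2 * phi1 z)^-1.
Let N2 z := (phi2 z * Z z + 2 * phi1 z) ^+ 2 * (phi1 z ^+ 2 * phi1 z)^-1.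

Let cube_neq0 z : phi1 z != 0 -> phi1 z ^+ 2 * phi1 z != 0.
Proof. by move=> n; rewrite mulf_neq0// expf_neq0. Qed.

Let wV z : Omega z -> phi1 z != 0 ->
  wirtinger (fun w => (phi1 w ^+ 2 * phi1 w)^-1) z (- (3 * phi2 z) / phi1 z ^+ 4) 0.
Proof.
move=> Oz n; have W := wirtingerM (wirtingerX (w1 Oz)) (w1 Oz).
rewrite !mulr0 mul0r addr0 in W.
have := wirtingerV W (cube_neq0 n).
by congr wirtinger; field.
Qed.

(** Each of the three z-derivatives is a multiple of 2 phi' phi''' - 3 phi''^2. *)
Let wN z : Omega z -> phi1 z != 0 ->
  [/\ wirtinger N0 z 0 0, wirtinger N1 z 0 0 & wirtinger N2 z 0 0].
Proof.
move=> Oz n.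
have S := schwarzian0 Oz.
have WZ := wirtinger_cplane z.
have V := wV Oz n.
have n2 : wirtinger (fun w => phi2 w * Z w + 2 * phi1 w) z
    (phi3 z * Z z + phi2 z + 2 * phi2 z) 0.
  have := wirtingerD (wirtingerM (w2 Oz) WZ) (wirtingerM (wirtinger_cst 2 z) (w1 Oz)).
  by congr wirtinger; ring.
have n1 : wirtinger (fun w => phi2 w ^+ 2 * Z w + 2 * phi1 w * phi2 w) z
   (2 * phi2 z * phi3 z * Z z + phi2 z ^+ 2 + 2 * phi2 z ^+ 2 + 2 * phi1 z * phi3 z) 0.
  have := wirtingerD (wirtingerM (wirtingerX (w2 Oz)) WZ)
     (wirtingerM (wirtingerM (wirtinger_cst 2 z) (w1 Oz)) (w2 Oz)).
  by congr wirtinger; ring.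
split.
- have := wirtingerM (wirtingerX (w2 Oz)) V; congr wirtinger; last by ring.
  transitivity ((2 * phi1 z * phi3 z - 3 * phi2 z ^+ 2) * phi2 z / phi1 z ^+ 4).
    by field.
  by rewrite S subrr !mul0r.
- have := wirtingerM n1 V; congr wirtinger; last by ring.
  transitivity ((2 * phi1 z * phi3 z - 3 * phi2 z ^+ 2) *
     (phi2 z * Z z + phi1 z) / phi1 z ^+ 4); first by field.
  by rewrite S subrr !mul0r.
- have := wirtingerM (wirtingerX n2) V; congr wirtinger; last by ring.
  transitivity ((2 * phi1 z * phi3 z - 3 * phi2 z ^+ 2) *
     (phi2 z * Z z + 2 * phi1 z) * Z z / phi1 z ^+ 4); first by field.
  by rewrite S subrr !mul0r.
Qed.

Let N_locally_constant z : Omega z -> phi1 z != 0 -> \forall w \near z,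
  [/\ phi1 w != 0, N0 w = N0 z, N1 w = N1 z & N2 w = N2 z].
Proof.
move=> Oz n.
have /nbhs_ballP[e /= e0 zV] : nbhs z [set w | phi1 w != 0 /\ Omega w].
  exact: filterI (contC_neq0 (holomorphic_contC h1 Oz) n) (nearO Oz).
have zB : nbhs z (ball z e) by exact: nbhsx_ballx.
have H w : ball z e w -> [/\ wirtinger N0 w 0 0, wirtinger N1 w 0 0 & wirtinger N2 w 0 0].
  by move=> /zV[nw Ow]; exact: wN.
apply: filterS zB => w zw; split; first by have [] := zV w zw.
- by apply: (ball_constantC _ zw) => w' /H[].
- by apply: (ball_constantC _ zw) => w' /H[].
- by apply: (ball_constantC _ zw) => w' /H[].
Qed.

(* 4 / phi' is the quadratic polynomial N2 - 2 N1 z + N0 z^2, whose coefficients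
   are locally constant where phi' != 0; being nonzero there, it also prevents
   phi' from vanishing on the boundary of that set. *)
Lemma inverse_quadratic z0 : Omega z0 -> phi1 z0 != 0 ->
  exists A B D : C, A * D = B ^+ 2 /\
    forall z, Omega z -> phi1 z * (A - 2 * B * Z z + D * Z z ^+ 2) = 1.
Proof.
move=> Oz0 n0.
have quad z : phi1 z != 0 ->
    phi1 z * (N2 z / 4 - 2 * (N1 z / 4) * Z z + N0 z / 4 * Z z ^+ 2) = 1.
  by move=> n; rewrite /N0 /N1 /N2; field; rewrite n.
exists (N2 z0 / 4), (N1 z0 / 4), (N0 z0 / 4); split.
  by rewrite /N0 /N1 /N2; field; rewrite n0.
pose poly z := N2 z0 / 4 - 2 * (N1 z0 / 4) * Z z + N0 z0 / 4 * Z z ^+ 2.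
pose good w := [/\ phi1 w != 0, N0 w = N0 z0, N1 w = N1 z0 & N2 w = N2 z0].
have goodP z : good z -> phi1 z * poly z = 1.
  by move=> [n e0 e1 e2]; rewrite /poly -e0 -e1 -e2; exact: quad.
have : forall z, Omega z -> good z.
  apply: (connected_propagate oO cO _ _ Oz0) => //.
  - move=> z Oz [n e0 e1 e2]; apply: filterS (N_locally_constant Oz n).
    by move=> w [nw f0 f1 f2]; split; [exact: nw|rewrite f0|rewrite f1|rewrite f2].
  - move=> z Oz ng; have [z1|n] := eqVneq (phi1 z) 0.
      have c1 : contC (fun w => 1 - phi1 w * poly w) z.
        apply: contCD; first exact: contC_cst.
        have -> : (fun w => - (phi1 w * poly w)) = (fun w => -1 * (phi1 w * poly w)).
          by apply/funext => w; rewrite mulN1r.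
        apply: contCM; first exact: contC_cst.
        apply: contCM; first exact: holomorphic_contC h1 Oz.
        have cZ := contC_cplane z.
        have -> : poly = (fun w => N2 z0 / 4 + (- 2 * (N1 z0 / 4)) * Z w
            + N0 z0 / 4 * (Z w * Z w)) by apply/funext => w; rewrite /poly; ring.
        apply: contCD; last by apply: contCM; [exact: contC_cst|exact: contCM].
        by apply: contCD; [exact: contC_cst|apply: contCM; [exact: contC_cst|]].
      have := contC_neq0 c1; rewrite z1 mul0r subr0 oner_eq0 => /(_ isT).
      by apply: filterS => w + /goodP => /[swap] ->; rewrite subrr eqxx.
    apply: filterS (N_locally_constant Oz n) => w [nw e0 e1 e2] [_ f0 f1 f2].
    by apply: ng; split; [exact: n|rewrite -e0|rewrite -e1|rewrite -e2].
by move=> G z Oz; exact/goodP/G.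
Qed.

(** With phi'' = 0 the differentiated ruling equation reduces to P = Q conj c, whose z-derivative is
    1 = c conj c. *)
Lemma affine_case (c : C) z0 : Omega z0 -> c != 0 -> (forall z, Omega z -> phi1 z = c) ->
  c * conjc c = 1 /\ exists d, forall z, Omega z -> phi z = c * Z z + d.
Proof.
move=> Oz0 c0 H; split.
  have H2 z : Omega z -> phi2 z = 0.
    move=> Oz; have N : \forall w \near z, phi1 w = c.
      by apply: filterS (nearO Oz) => w; exact: H.
    by have [] := wirtinger_unique (wirtinger_near N (w1 Oz)) (wirtinger_cst c z).
  have E z : Omega z -> P z = Q z * conjc c.
    move=> Oz; have := ruled_dz Oz; rewrite H2// mulr0 H// => E.
    have c2 : 2 * c != 0 by rewrite mulf_neq0// two_neq0.
    apply: (mulfI c2); transitivity (0 + 2 * P z * c); first by ring.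
    by rewrite E; ring.
  have N : \forall w \near z0, P w = Q w * conjc c.
    by apply: filterS (nearO Oz0) => w; exact: E.
  have [+ _] := wirtinger_unique (wirtinger_near N (wP Oz0))
     (wirtingerM (wQ Oz0) (wirtinger_cst (conjc c) z0)).
  by rewrite H// mulr0 addr0.
have dO : domain Omega by split => //; exists z0.
have [d Hd] : exists d, forall z, Omega z -> phi z - c * Z z = d.
  apply: domain_constantC dO _ => z Oz.
  have := wirtingerB (w0 Oz) (wirtingerM (wirtinger_cst c z) (wirtinger_cplane z)).
  by rewrite H//; congr wirtinger; ring.
by exists d => z Oz; rewrite -(Hd z Oz); ring.
Qed.

(** Integration gives phi = d - k / (z - s), and e = s + conj d has to vanish. With x = z - s and y
    = conj x, the ruling equation and its z-derivative combine to P (y + conj e) = x Q. After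
    clearing denominators x cancels and the polynomial [pol] in y alone remains. Two derivatives in
    conj z give e = 0, and then the linear coefficient k - conj k is 0. *)
Lemma moebius_case (k s : C) z0 : Omega z0 -> k != 0 ->
  (forall z, Omega z -> Z z - s != 0) ->
  (forall z, Omega z -> phi1 z = k / (Z z - s) ^+ 2) ->
  conjc k = k /\ forall z, Omega z -> phi z = - conjc s - k / (Z z - s).
Proof.
move=> Oz0 k0 n H.
have wI z : Omega z -> wirtinger (fun w => (Z w - s)^-1) z (- 1 / (Z z - s) ^+ 2) 0.
  move=> Oz; apply: wirtingerV (n z Oz).
  by have := wirtingerB (wirtinger_cplane z) (wirtinger_cst s z); rewrite !subr0.
have dO : domain Omega by split => //; exists z0.
have [d Hd] : exists d, forall z, Omega z -> phi z + k * (Z z - s)^-1 = d.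
  apply: domain_constantC dO _ => z Oz.
  have := wirtingerD (w0 Oz) (wirtingerM (wirtinger_cst k z) (wI z Oz)).
  by rewrite H//; congr wirtinger; field; exact: n.
have H2 z : Omega z -> phi2 z = - 2 * k / (Z z - s) ^+ 3.
  move=> Oz.
  have N : \forall w \near z, phi1 w = k * (Z w - s)^-1 ^+ 2.
    by apply: filterS (nearO Oz) => w Ow; rewrite H// exprVn.
  have [-> _] := wirtinger_unique (wirtinger_near N (w1 Oz))
    (wirtingerM (wirtinger_cst k z) (wirtingerX (wI z Oz))).
  by field; exact: n.
set e := s + conjc d.
have Hphi z : Omega z -> phi z = d - k * (Z z - s)^-1.
  by move=> Oz; rewrite -(Hd z Oz); ring.
pose y z := conjc (Z z) - conjc s.
have ey z : y z = conjc (Z z - s) by rewrite /y rmorphB.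
pose pol z := e * y z ^+ 2 + (e * conjc e + k - conjc k) * y z - conjc k * conjc e.
have wy z : wirtinger y z 0 1.
  have := wirtingerB (wirtingerJ (wirtinger_cplane z)) (wirtinger_cst (conjc s) z).
  by rewrite rmorph0 rmorph1 !subr0.
have wpol z : wirtinger pol z 0 (2 * e * y z + (e * conjc e + k - conjc k)).
  have := wirtingerB (wirtingerD (wirtingerM (wirtinger_cst e z) (wirtingerX (wy z)))
    (wirtingerM (wirtinger_cst (e * conjc e + k - conjc k) z) (wy z)))
    (wirtinger_cst (conjc k * conjc e) z).
  by congr wirtinger; ring.
have pol0 z : Omega z -> pol z = 0.
  apply: Q_neq0_dense => [w Ow|w Ow Qw]; first by have [] := wpol w.
  have x0 := n w Ow.
  have y0 : y w != 0 by rewrite ey conjc_eq0.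
  have eJ : conjc e = conjc s + d by rewrite /e rmorphD /= conjcK.
  have QE : Q w = y w + conjc e - k / (Z w - s).
    by rewrite /Q Hphi// eJ /y; ring.
  have PE : P w = Z w - s + e - conjc k / y w.
    rewrite /P Hphi// /e ey -conjc_inv rmorphB rmorphM /=; ring.
  have r0 := ruled Ow; have r1 := ruled_dz Ow; have P0 := P_neq0 Qw.
  have a0 : phi1 w != 0 by rewrite H// mulf_neq0// invr_eq0 expf_neq0.
  have bE : phi2 w = - 2 * phi1 w / (Z w - s) by rewrite H2// H//; field.
  have aE : phi1 w * (Z w - s) = k / (Z w - s) by rewrite H//; field.
  rewrite /pol.
  move: (conjc (phi1 w)) r0 r1 => a'; move: (y w) y0 QE PE => yw y0.
  move: (conjc e) (conjc k) => ee kk {ey eJ}.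
  move: (Z w - s) x0 bE aE (P w) (Q w) P0 Qw => x x0 bE aE p q p0 q0 QE PE r0.
  rewrite bE => r1.
  have K1 : p ^+ 2 = x * (p - q * a').
    have aa : - 2 * phi1 w / x != 0.
      by rewrite !mulf_neq0// ?invr_eq0// oppr_eq0 two_neq0.
    by apply: (mulIf aa); rewrite r1; field.
  (* Multiplied by q, K1 contains q^2 conj phi', which the ruling equation replaces by p^2 phi';
     this removes conj phi'. *)
  have K2 : p * q = x * (q - p * phi1 w).
    apply: (mulfI p0); transitivity (p ^+ 2 * q); first by ring.
    rewrite K1; transitivity (x * (p * q - q ^+ 2 * a')); first by ring.
    by rewrite -r0; ring.
  have K3 : p * (yw + ee) = x * q.
    have -> : yw + ee = q + k / x by rewrite QE; ring.
    by rewrite mulrDr K2 -aE; ring.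
  have K4 : (yw * p) * (yw + ee) = yw * (x * q) by rewrite -K3; ring.
  have E1 : yw * p = x * yw + e * yw - kk by rewrite PE; field.
  have E2 : x * q = x * yw + ee * x - k by rewrite QE; field.
  move: K4; rewrite E1 E2 => K4.
  transitivity ((x * yw + e * yw - kk) * (yw + ee) - yw * (x * yw + ee * x - k)).
    by ring.
  by rewrite K4 subrr.
have d1 z : Omega z -> 2 * e * y z + (e * conjc e + k - conjc k) = 0.
  move=> Oz; have N : \forall w \near z, pol w = 0.
    by apply: filterS (nearO Oz) => w; exact: pol0.
  by have [_ +] := wirtinger_unique (wirtinger_near N (wpol z)) (wirtinger_cst 0 z).
have e0 : e = 0.
  have N : \forall w \near z0, 2 * e * y w + (e * conjc e + k - conjc k) = 0.
    by apply: filterS (nearO Oz0) => w; exact: d1.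
  have W := wirtingerD (wirtingerM (wirtinger_cst (2 * e) z0) (wy z0))
    (wirtinger_cst (e * conjc e + k - conjc k) z0).
  have [_ +] := wirtinger_unique (wirtinger_near N W) (wirtinger_cst 0 z0).
  rewrite mul0r add0r addr0 mulr1 => /eqP; rewrite mulf_eq0 (negPf (two_neq0 R)) => /eqP.
  exact.
split.
  have := d1 z0 Oz0; rewrite e0 !(mulr0, mul0r, add0r) => /subr0_eq/esym.
  exact.
move=> z Oz; rewrite (Hphi z Oz); congr (_ - _).
have : conjc e = 0 by rewrite e0 rmorph0.
by rewrite /e rmorphD /= conjcK addrC => /eqP; rewrite addr_eq0 => /eqP.
Qed.

Lemma phi_classification : Omega !=set0 ->
  [\/ exists d, forall z, Omega z -> phi z = d,
      exists c d, c * conjc c = 1 /\ forall z, Omega z -> phi z = c * Z z + d |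
      exists (k : R) (s : C), k != 0 /\ forall z, Omega z ->
        Z z != s /\ phi z = - conjc s - k%:C%C / (Z z - s)].
Proof.
move=> O0.
have dO : domain Omega by split.
have [Hz|] := pselect (forall z, Omega z -> phi1 z = 0).
  apply: Or31; apply: domain_constantC dO _ => z Oz.
  by have := w0 Oz; rewrite Hz.
move=> /existsNP[z0 /not_implyP[Oz0 /eqP n0]].
have [A [B [D [AD H]]]] := inverse_quadratic Oz0 n0.
(* The quadratic 1 / phi' has discriminant 0. Either it is constant, or it has the double root B /
   D, which lies outside Omega because its product with phi' is 1 there. *)
have [D0|D0] := eqVneq D 0.
  have B0 : B = 0.
    by move: AD; rewrite D0 mulr0 => /esym/eqP; rewrite sqrf_eq0 => /eqP.
  have HA z : Omega z -> phi1 z * A = 1.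
    by move=> Oz; rewrite -[RHS](H z Oz) D0 B0; congr (_ * _); ring.
  have A0 : A != 0.
    apply/eqP => A0; have /eqP := HA z0 Oz0.
    by rewrite A0 mulr0 eq_sym oner_eq0.
  have := @affine_case A^-1 z0 Oz0; rewrite invr_eq0 A0 => /(_ isT)[].
    by move=> z Oz; apply: (mulIf A0); rewrite HA// mulVf.
  by move=> cc [d Hd]; apply: Or32; exists A^-1, d.
have HD z : Omega z -> phi1 z * (D * (Z z - B / D) ^+ 2) = 1.
  move=> Oz; rewrite -[RHS](H z Oz); congr (_ * _).
  have -> : A = B ^+ 2 / D by rewrite -AD mulfK.
  by field.
have nz z : Omega z -> Z z - B / D != 0.
  move=> Oz; apply/eqP => E; have := HD z Oz.
  by rewrite E expr0n /= !mulr0 => /esym/eqP; rewrite oner_eq0.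
have := @moebius_case D^-1 (B / D) z0 Oz0; rewrite invr_eq0 D0 => /(_ isT nz)[].
  move=> z Oz; have n := nz z Oz.
  have nn : D * (Z z - B / D) ^+ 2 != 0 by rewrite mulf_neq0// expf_neq0.
  apply: (mulIf nn); rewrite HD//; move: (Z z - B / D) n => x x0; field.
  by rewrite D0 x0.
move=> kr Hphi; apply: Or33.
have kE : (complex.Re D^-1)%:C%C = D^-1.
  by move: kr; case: (D^-1) => a b [] /eqP; rewrite eqNr => /eqP ->.
exists (complex.Re D^-1), (B / D); split.
  apply: contraNneq D0 => k0; rewrite -invr_eq0 -kE k0; exact: eqxx.
move=> z Oz; split; first by rewrite -subr_eq0; exact: nz.
by rewrite kE; exact: Hphi.
Qed.

End Classification.

(** * The equations of a persistent graph *)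

Section MinimalGraphs.
Variable R : realType.
Implicit Types (Omega : set (plane R)) (u : plane R -> R) (z : plane R) (l : R)
  (P v w n : heis R).
Local Notation ex := (@e_x R).
Local Notation ey := (@e_y R).

Lemma derive_c3 P v w :
  is_derive P v (fun Q => c3 Q w) (v.1.2 / 2 * w.1.1 - v.1.1 / 2 * w.1.2).
Proof.
apply: is_derive_affine => h; rewrite /c3.
case: P v w => [[P1 P2] P3] [[v1 v2] v3] [[w1 w2] w3].
by rewrite /= /GRing.scale /=; ring.
Qed.

Lemma derive_g l P v w n : 'D_v (fun Q => g l Q w n) P =
  l ^+ 2 * ((v.1.2 / 2 * w.1.1 - v.1.1 / 2 * w.1.2) * c3 P n
          + c3 P w * (v.1.2 / 2 * n.1.1 - v.1.1 / 2 * n.1.2)).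
Proof.
have D := is_deriveD (is_derive_cst (w.1.1 * n.1.1 + w.1.2 * n.1.2) P v)
  (is_deriveZ (l ^+ 2) (is_deriveM (derive_c3 P v w) (derive_c3 P v n))).
have -> : (fun Q => g l Q w n) =
  (cst (w.1.1 * n.1.1 + w.1.2 * n.1.2) + l ^+ 2 \*: ((c3 (R:=R))^~ w * (c3 (R:=R))^~ n)).
  by apply/funext => Q.
rewrite (@derive_val _ _ _ _ _ _ _ D) add0r.
rewrite /GRing.scale /=; ring.
Qed.

Lemma christoffelE l P v w n : christoffel l P v w n = l ^+ 2 / 2 *
  ((v.1.2 / 2 * w.1.1 - v.1.1 / 2 * w.1.2) * c3 P n
   + c3 P w * (v.1.2 / 2 * n.1.1 - v.1.1 / 2 * n.1.2)
   + ((w.1.2 / 2 * v.1.1 - w.1.1 / 2 * v.1.2) * c3 P n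
   + c3 P v * (w.1.2 / 2 * n.1.1 - w.1.1 / 2 * n.1.2))
   - ((n.1.2 / 2 * v.1.1 - n.1.1 / 2 * v.1.2) * c3 P w
   + c3 P v * (n.1.2 / 2 * w.1.1 - n.1.1 / 2 * w.1.2))).
Proof. by rewrite /christoffel !derive_g; ring. Qed.

Lemma riemannian_minimal_eq l Omega u z : l != 0 -> Omega z ->
  riemannian_minimal l Omega u ->
  'D_ex ('D_ex u) z + 'D_ey ('D_ey u) z + l ^+ 2 *
   (q u z ^+ 2 * 'D_ex ('D_ex u) z - 2 * p u z * q u z * 'D_ex ('D_ey u) z
    + p u z ^+ 2 * 'D_ey ('D_ey u) z) = 0.
Proof.
move=> l0 Oz rm.
(* The gradient of t - u for g_l is p X1 + q X2 + l^(-2) T; n is l^2 times this vector, written in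
   coordinates. The resulting equation carries an overall factor l^2. *)
pose n : heis R := (l ^+ 2 * p u z, l ^+ 2 * q u z,
  1 - z.2 / 2 * (l ^+ 2 * p u z) + z.1 / 2 * (l ^+ 2 * q u z)).
have l2 : l ^+ 2 != 0 by rewrite expf_neq0.
apply: (mulfI l2); rewrite mulr0.
have := rm z Oz n; rewrite /second_form !christoffelE.
rewrite /g /c1 /c2 /c3 /tangent /n /p /q /=.
move: ('D_ex ('D_ex u) z) ('D_ex ('D_ey u) z) ('D_ey ('D_ey u) z).
move: ('D_ex u z) ('D_ey u z).
case: z {Oz n} => x y a b axx axy byy /=.
move=> H; rewrite -[RHS]H; last 2 first.
- by field.
- by field.
by field.
Qed.

Lemma affine_two_roots (A B : R) :
  A + 1 ^+ 2 * B = 0 -> A + 2 ^+ 2 * B = 0 -> A = 0 /\ B = 0.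
Proof. by move=> H1 H2; split; lra. Qed.

Lemma persistent_eqs Omega u z : persistent Omega u -> Omega z ->
  'D_ex ('D_ex u) z + 'D_ey ('D_ey u) z = 0 /\
  q u z ^+ 2 * 'D_ex ('D_ex u) z - 2 * p u z * q u z * 'D_ex ('D_ey u) z
    + p u z ^+ 2 * 'D_ey ('D_ey u) z = 0.
Proof.
move=> [_ _ rm] Oz.
have E1 := riemannian_minimal_eq (oner_neq0 R) Oz (rm 1 (lexx _)).
have two0 : 2 != 0 :> R by rewrite pnatr_eq0.
have E2 := riemannian_minimal_eq two0 Oz (rm 2 (ler1n _ _)).
exact: affine_two_roots E1 E2.
Qed.

End MinimalGraphs.

(** * Isometries of the Heisenberg group *)

Section Isometries.
Variable R : realType.
Implicit Types (P Q v : heis R) (gamma : R -> heis R) (f h : R -> R)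
  (Phi Psi L M : heis R -> heis R).

Lemma abs_continuous01_cst (c : R) : abs_continuous01 (fun=> c).
Proof.
move=> e e0; exists 1 => // n a b _ _ _.
by rewrite big1// => i _; rewrite subrr normr0.
Qed.

Lemma abs_continuous01D f h : abs_continuous01 f -> abs_continuous01 h ->
  abs_continuous01 (fun s => f s + h s).
Proof.
move=> fa ha e e0; have e2 : 0 < e / 2 by rewrite divr_gt0.
have [d1 d10 H1] := fa _ e2; have [d2 d20 H2] := ha _ e2.
exists (Num.min d1 d2); first by rewrite lt_min d10.
move=> n a b I T; rewrite lt_min => /andP[S1 S2].
apply: le_lt_trans (_ : _ <= \sum_(i < n) `|f (b i) - f (a i)|
    + \sum_(i < n) `|h (b i) - h (a i)|) _.
  rewrite -big_split /=; apply: ler_sum => i _.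
  by rewrite opprD addrACA ler_normD.
by rewrite (splitr e) ltrD// ?H1// H2.
Qed.

Lemma abs_continuous01Z (c : R) f : abs_continuous01 f ->
  abs_continuous01 (fun s => c * f s).
Proof.
(* The added 1 keeps the divisor positive when c = 0. *)
move=> fa e e0; have c0 : 0 < `|c| + 1 by rewrite ltr_wpDl.
have [d d0 H] := fa _ (divr_gt0 e0 c0).
exists d => // n a b I T S; have := H n a b I T S.
rewrite ltr_pdivlMr// mulrC; apply: le_lt_trans; rewrite mulr_sumr.
apply: ler_sum => i _; rewrite -mulrBr normrM ler_wpM2r//.
by rewrite lerDl.
Qed.

Lemma horizontalP P v : (exists a b : R, v = a *: X1 P + b *: X2 P) <-> c3 P v = 0.
Proof.
split=> [[a [b ->]]|v0].
  by case: P => [[x y] t]; rewrite /c3 /X1 /X2 /= /GRing.scale /=; ring.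
by exists (c1 P v), (c2 P v); rewrite [LHS](frameE P v) v0 scale0r addr0.
Qed.

(* An affine map Phi with linear part L that preserves the frame coordinates
   seen by the length and by the horizontal distribution. *)
Definition frame_isometry Phi L : Prop :=
  [/\ forall P Q, Phi P - Phi Q = L (P - Q),
      forall (k : R) P, L (k *: P) = k *: L P,
      continuous L,
      forall P v, c3 (Phi P) (L v) = c3 P v &
      forall P v, c1 (Phi P) (L v) ^+ 2 + c2 (Phi P) (L v) ^+ 2 =
                  c1 P v ^+ 2 + c2 P v ^+ 2].

Lemma frame_isometry_derive Phi L gamma (s : R) v : frame_isometry Phi L ->
  is_derive s 1 gamma v -> is_derive s 1 (Phi \o gamma) (L v).
Proof.
move=> [PL LZ Lc _ _] [gd gv].
have H : h^-1 *: (gamma (h *: 1 + s) - gamma s) @[h --> (0 : R)^'] --> v.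
  by rewrite -gv; exact: gd.
have H' : h^-1 *: (Phi (gamma (h *: 1 + s)) - Phi (gamma s)) @[h --> (0 : R)^'] --> L v.
  under eq_fun do rewrite PL -LZ.
  exact: (cvg_comp _ _ H (Lc v)).
split; first by rewrite /derivable; apply/cvg_ex; exists (L v).
by rewrite /derive; exact/cvg_lim.
Qed.

Definition ac_path gamma : Prop :=
  [/\ abs_continuous01 (fun s => (gamma s).1.1),
      abs_continuous01 (fun s => (gamma s).1.2) &
      abs_continuous01 (fun s => (gamma s).2)].

(** Horizontality is tested only where a path has a derivative, so derivability has to be carried
    back from Phi \o gamma to gamma. The inverse isometry will supply this. *)
Lemma horizontal_path_frame Phi L gamma P Q : frame_isometry Phi L ->
  (forall gamma, ac_path gamma -> ac_path (Phi \o gamma)) ->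
  (forall s : R, derivable (Phi \o gamma) s 1 -> derivable gamma s 1) ->
  horizontal_path gamma P Q -> horizontal_path (Phi \o gamma) (Phi P) (Phi Q).
Proof.
move=> FI ac dinv [g0 g1 gac gh]; split; [by rewrite /= g0|by rewrite /= g1|exact: ac|].
move=> s s01 /dinv gd; apply/horizontalP.
have [_ ->] := frame_isometry_derive FI (derivableP gd).
have [_ _ _ C3 _] := FI.
by rewrite /= C3; apply/horizontalP; exact: gh.
Qed.

Lemma speedE gamma (s : R) v : is_derive s 1 gamma v ->
  speed gamma s = Num.sqrt (c1 (gamma s) v ^+ 2 + c2 (gamma s) v ^+ 2).
Proof. by move=> [d <-]; rewrite /speed asboolT. Qed.

Lemma speed0 gamma (s : R) : ~ derivable gamma s 1 -> speed gamma s = 0.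
Proof. by move=> nd; rewrite /speed asboolF. Qed.

Lemma speed_frame Phi L gamma (s : R) : frame_isometry Phi L ->
  (derivable (Phi \o gamma) s 1 -> derivable gamma s 1) ->
  speed (Phi \o gamma) s = speed gamma s.
Proof.
move=> FI dinv.
have [d|nd] := pselect (derivable gamma s 1).
  have D := derivableP d.
  rewrite (speedE D) (speedE (frame_isometry_derive FI D)).
  by have [_ _ _ _ ->] := FI.
by rewrite (speed0 nd) (speed0 (fun d => nd (dinv d))).
Qed.

(** Composition with Phi and with Psi matches the horizontal paths between two points with those
    between their images. Matched paths have equal speed at every parameter, so the two infima are
    over the same set of lengths. *)
Lemma frame_isometry_dcc Phi Psi L M : cancel Phi Psi -> cancel Psi Phi ->
  frame_isometry Phi L -> frame_isometry Psi M ->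
  (forall gamma, ac_path gamma -> ac_path (Phi \o gamma)) ->
  (forall gamma, ac_path gamma -> ac_path (Psi \o gamma)) ->
  dcc_isometry Phi.
Proof.
move=> K1 K2 F1 F2 a1 a2.
have E1 gamma : Psi \o (Phi \o gamma) = gamma by apply/funext => s /=; rewrite K1.
have E2 gamma : Phi \o (Psi \o gamma) = gamma by apply/funext => s /=; rewrite K2.
have d1 gamma (s : R) : derivable (Phi \o gamma) s 1 -> derivable gamma s 1.
  move=> d; have [] := frame_isometry_derive F2 (derivableP d).
  by rewrite E1.
have d2 gamma (s : R) : derivable (Psi \o gamma) s 1 -> derivable gamma s 1.
  move=> d; have [] := frame_isometry_derive F1 (derivableP d).
  by rewrite E2.
have l1 gamma : path_length (Phi \o gamma) = path_length gamma.
  by rewrite /path_length; apply: eq_integral => s _; rewrite (speed_frame F1 (@d1 _ _)).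
have l2 gamma : path_length (Psi \o gamma) = path_length gamma.
  by rewrite /path_length; apply: eq_integral => s _; rewrite (speed_frame F2 (@d2 _ _)).
split; first by exists Psi.
move=> P Q; rewrite /dcc; congr ereal_inf; apply/seteqP; split => _ /= [gamma hg <-].
  exists (Psi \o gamma); last exact: l2.
  have := horizontal_path_frame F2 a2 (@d2 gamma) hg.
  by rewrite !K1.
exists (Phi \o gamma); last exact: l1.
exact: horizontal_path_frame F1 a1 (@d1 gamma) hg.
Qed.

Definition translation (A : heis R) P : heis R :=
  (A.1.1 + P.1.1, A.1.2 + P.1.2,
   A.2 + P.2 + (A.1.1 * P.1.2 - P.1.1 * A.1.2) / 2).

Definition quarter_turn P : heis R := (- P.1.2, P.1.1, P.2).
Definition quarter_turn_inv P : heis R := (P.1.2, - P.1.1, P.2).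

Lemma heis_eqP P Q : P.1.1 = Q.1.1 -> P.1.2 = Q.1.2 -> P.2 = Q.2 -> P = Q.
Proof. by case: P Q => [[? ?] ?] [[? ?] ?] /= -> -> ->. Qed.

Lemma continuous_heis (L : heis R -> heis R) :
  continuous (fun P => (L P).1.1) -> continuous (fun P => (L P).1.2) ->
  continuous (fun P => (L P).2) -> continuous L.
Proof.
move=> c1 c2 c3 P.
have -> : L = (fun P => ((L P).1.1, (L P).1.2, (L P).2)).
  by apply/funext => Q; case: (L Q) => [[? ?] ?].
by apply: cvg_pair2; [apply: cvg_pair2; [exact: c1|exact: c2]|exact: c3].
Qed.

Lemma continuous_coord1 : continuous (fun P : heis R => P.1.1).
Proof.
move=> [z t]; apply: (cvg_comp _ _ (@cvg_fst _ _ (nbhs z) (nbhs t) _)).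
by case: z => x y; exact: (@cvg_fst _ _ (nbhs x) (nbhs y) _).
Qed.
Lemma continuous_coord2 : continuous (fun P : heis R => P.1.2).
Proof.
move=> [z t]; apply: (cvg_comp _ _ (@cvg_fst _ _ (nbhs z) (nbhs t) _)).
by case: z => x y; exact: (@cvg_snd _ _ (nbhs x) (nbhs y) _).
Qed.
Lemma continuous_coord3 : continuous (fun P : heis R => P.2).
Proof. by move=> [z t]; exact: (@cvg_snd _ _ (nbhs z) (nbhs t) _). Qed.

Lemma translation_frame A : frame_isometry (translation A)
  (fun v => (v.1.1, v.1.2, v.2 + (A.1.1 * v.1.2 - v.1.1 * A.1.2) / 2)).
Proof.
split.
- by move=> P Q; apply: heis_eqP; rewrite /translation /=; ring.
- by move=> k P; apply: heis_eqP; rewrite /= /GRing.scale /=; ring.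
- apply: continuous_heis => /=; [exact: continuous_coord1|exact: continuous_coord2|].
  move=> P; apply: cvgD; first exact: continuous_coord3.
  apply: cvgM; last exact: cvg_cst.
  apply: cvgB; apply: cvgM; [exact: cvg_cst|exact: continuous_coord2|
    exact: continuous_coord1|exact: cvg_cst].
- by move=> P v; rewrite /translation /c3 /=; field.
- by move=> P v; rewrite /translation /c1 /c2 /=.
Qed.

Lemma translation_ac A gamma : ac_path gamma -> ac_path (translation A \o gamma).
Proof.
move=> [g1 g2 g3]; rewrite /translation; split => /=.
- by apply: abs_continuous01D => //; exact: abs_continuous01_cst.
- by apply: abs_continuous01D => //; exact: abs_continuous01_cst.
- have -> : (fun s => A.2 + (gamma s).2 +
      (A.1.1 * (gamma s).1.2 - (gamma s).1.1 * A.1.2) / 2) =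
    (fun s => (A.2 + (gamma s).2) +
      (A.1.1 / 2 * (gamma s).1.2 + (- (A.1.2 / 2)) * (gamma s).1.1)).
    by apply/funext => s; ring.
  apply: abs_continuous01D.
    by apply: abs_continuous01D => //; exact: abs_continuous01_cst.
  by apply: abs_continuous01D; exact: abs_continuous01Z.
Qed.

Lemma translationK A : cancel (translation A) (translation (- A)).
Proof. by move=> P; apply: heis_eqP; rewrite /translation /=; ring. Qed.

Lemma translation_isometry A : dcc_isometry (translation A).
Proof.
apply: frame_isometry_dcc (translationK A) _ (translation_frame A)
  (translation_frame (- A)) (@translation_ac A) (@translation_ac (- A)).
by have := translationK (- A); rewrite opprK.
Qed.

Lemma quarter_turn_isometry : dcc_isometry quarter_turn.
Proof.
have F1 : frame_isometry quarter_turn quarter_turn.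
  split.
  - by move=> P Q; apply: heis_eqP; rewrite /quarter_turn /=; ring.
  - by move=> k P; apply: heis_eqP; rewrite /= /GRing.scale /=; ring.
  - apply: continuous_heis => /=; [|exact: continuous_coord1|exact: continuous_coord3].
    by move=> P; apply: cvgN; exact: continuous_coord2.
  - by move=> P v; rewrite /quarter_turn /c3 /=; field.
  - by move=> P v; rewrite /quarter_turn /c1 /c2 /=; ring.
have F2 : frame_isometry quarter_turn_inv quarter_turn_inv.
  split.
  - by move=> P Q; apply: heis_eqP; rewrite /quarter_turn_inv /=; ring.
  - by move=> k P; apply: heis_eqP; rewrite /= /GRing.scale /=; ring.
  - apply: continuous_heis => /=; [exact: continuous_coord2| |exact: continuous_coord3].
    by move=> P; apply: cvgN; exact: continuous_coord1.
  - by move=> P v; rewrite /quarter_turn_inv /c3 /=; field.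
  - by move=> P v; rewrite /quarter_turn_inv /c1 /c2 /=; ring.
have N f : abs_continuous01 f -> abs_continuous01 (fun s => - f s).
  move=> fa; have -> : (fun s => - f s) = (fun s => -1 * f s).
    by apply/funext => s; rewrite mulN1r.
  exact: abs_continuous01Z.
apply: frame_isometry_dcc F1 F2 _ _.
- by move=> P; apply: heis_eqP; rewrite /quarter_turn_inv /= ?opprK.
- by move=> P; apply: heis_eqP; rewrite /quarter_turn /= ?opprK.
- by move=> gamma [g1 g2 g3]; split => //=; exact: N.
- by move=> gamma [g1 g2 g3]; split => //=; exact: N.
Qed.

End Isometries.

(** * The model surfaces *)

Section Models.
Variable R : realType.
Implicit Types (Omega : set (plane R)) (u : plane R -> R) (z w v : plane R).
Local Notation ex := (@e_x R).
Local Notation ey := (@e_y R).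
Local Notation C := R[i].

Lemma is_derive_comp_real (f : R -> R) (h : plane R -> R) z v (d e : R) :
  is_derive (h z) 1 f d -> is_derive z v h e -> is_derive z v (fun w => f (h w)) (d * e).
Proof.
move=> fd [hd he].
have L (k : plane R -> R) : (fun t : R => t^-1 *: ((k \o shift z) (t *: v) - k z)) =
    (fun t : R => t^-1 *: (k ((t + 0) *: v + z) - k (0 *: v + z))).
  by apply/funext => t /=; rewrite addr0 scale0r add0r.
have D1 : is_derive (0 : R) 1 (fun t : R => h (t *: v + z)) e.
  apply/is_derive1P; rewrite -(L h) -he; exact: hd.
have fd' : is_derive (h ((0 : R) *: v + z)) 1 f d by rewrite scale0r add0r.
have D2 : is_derive (0 : R) 1 (fun t : R => f (h (t *: v + z))) (d * e).
  exact: is_derive1_comp fd' D1.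
have H := (is_derive1P _ _ _).1 D2.
rewrite -(L (fun w => f (h w))) in H.
split; first by rewrite /derivable; apply/cvg_ex; eexists; exact: H.
by rewrite /derive; apply/cvg_lim => //; exact: H.
Qed.

Lemma derive_fst z : is_derive z ex (fun w => w.1) (1 : R) /\
  is_derive z ey (fun w => w.1) (0 : R).
Proof.
by split; apply: is_derive_affine => h; rewrite ?scale_ex ?scale_ey /=; ring.
Qed.

Lemma derive_snd z : is_derive z ex (fun w => w.2) (0 : R) /\
  is_derive z ey (fun w => w.2) (1 : R).
Proof.
by split; apply: is_derive_affine => h; rewrite ?scale_ex ?scale_ey /=; ring.
Qed.

Lemma gradient_constant Omega u (F Fx Fy : plane R -> R) : domain Omega ->
  (forall z, Omega z -> is_derive z ex u (Fx z) /\ is_derive z ey u (Fy z)) ->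
  (forall z, Omega z -> is_derive z ex F (Fx z) /\ is_derive z ey F (Fy z)) ->
  exists b, forall z, Omega z -> u z = F z + b.
Proof.
move=> dO Du DF.
have [b Hb] : exists b, forall z, Omega z -> u z - F z = b.
  apply: domain_constant dO _ => z Oz.
  have [ux uy] := Du z Oz; have [Fx' Fy'] := DF z Oz.
  have [dx ex_] := is_deriveB ux Fx'; have [dy ey_] := is_deriveB uy Fy'.
  by split; [exact: dx|exact: dy|rewrite -(subrr (Fx z)); exact: ex_|
    rewrite -(subrr (Fy z)); exact: ey_].
by exists b => z Oz; rewrite -(Hb z Oz) addrC subrK.
Qed.

Lemma unit_angle (c s : R) : c ^+ 2 + s ^+ 2 = 1 -> exists t, cos t = c /\ sin t = s.
Proof.
move=> cs.
have c1 : -1 <= c <= 1.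
  have c2 : c ^+ 2 <= 1 by rewrite -cs lerDl sqr_ge0.
  by apply/andP; split; nra.
have ac : cos (acos c) = c by apply: acosK; rewrite in_itv.
have as_ : sin (acos c) = `|s|.
  rewrite sin_acos// (_ : 1 - c ^+ 2 = s ^+ 2) ?sqrtr_sqr//.
  by rewrite -cs addrC addKr.
have [s0|s0] := leP 0 s.
  by exists (acos c); rewrite ac as_ ger0_norm.
by exists (- acos c); rewrite cosN sinN ac as_ ltr0_norm// opprK.
Qed.

(** The plane t = 0 is the degenerate helicoid with a = 0, so planes need no category of their
    own. *)
Lemma helicoid_flat z : helicoid (0 : R) 0 (z, 0).
Proof.
pose r2 := z.1 ^+ 2 + z.2 ^+ 2.
have [r0|r0] := eqVneq r2 0.
  exists 0, 0; split=> //; rewrite !mul0r addr0.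
  move/eqP: r0; rewrite paddr_eq0 ?sqr_ge0// !sqrf_eq0 => /andP[/eqP z1 /eqP z2].
  by case: z z1 z2 {r2} => x y /= -> ->.
pose r := Num.sqrt r2.
have r2p : 0 <= r2 by rewrite addr_ge0// sqr_ge0.
have rr : r ^+ 2 = r2 by rewrite sqr_sqrtr.
have rn : r != 0 by rewrite -sqrf_eq0 rr.
have [t [ct st]] : exists t, cos t = z.1 / r /\ sin t = z.2 / r.
  by apply: unit_angle; rewrite !expr_div_n rr -mulrDl mulfV.
exists r, t; split; first exact: sqrtr_ge0.
rewrite ct st mul0r addr0 !(mulrC r) !divfK//.
by case: (z).
Qed.

Lemma graph_image Omega u (Phi : heis R -> heis R) (tau : plane R -> plane R) u' :
  (forall z, Omega z -> Phi (z, u z) = (tau z, u' (tau z))) ->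
  Phi @` graph Omega u = graph (tau @` Omega) u'.
Proof.
move=> H; apply/seteqP; split => P /=.
  move=> [_ [z Oz <-] <-]; exists (tau z); first by exists z.
  by rewrite H.
by move=> [_ [z Oz <-] <-]; exists (z, u z); [exists z|rewrite H].
Qed.

Lemma domain_image Omega (tau sigma : plane R -> plane R) :
  continuous tau -> continuous sigma -> cancel tau sigma -> cancel sigma tau ->
  domain Omega -> domain (tau @` Omega).
Proof.
move=> tc sc K1 K2 [oO cO [z Oz]]; split.
- have -> : tau @` Omega = sigma @^-1` Omega.
    apply/seteqP; split=> w /=; first by move=> [z' Oz' <-]; rewrite K1.
    by move=> Ow; exists (sigma w).
  by apply: open_comp => // w _; exact: sc.
- by apply: connected_continuous_connected cO _; apply: continuous_subspaceT.
- by exists (tau z), z.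
Qed.

Definition classified Omega u : Prop :=
  exists (phi : heis R -> heis R) (Omega' : set (plane R)) (u' : plane R -> R),
    [/\ dcc_isometry phi, domain Omega',
        phi @` graph Omega u = graph Omega' u' &
        (exists m a b x0 y0 : R,
            forall z, Omega' z -> u' z = hyperbolic m a b x0 y0 z)
        \/ (exists a b : R, graph Omega' u' `<=` helicoid a b)].

Lemma translation_classified Omega u (A : heis R) : domain Omega ->
  (exists a b : R, forall z, Omega z -> helicoid a b (translation A (z, u z))) ->
  classified Omega u.
Proof.
move=> dO [a [b H]].
pose tau z : plane R := (A.1.1 + z.1, A.1.2 + z.2).
pose sigma z : plane R := (- A.1.1 + z.1, - A.1.2 + z.2).
have cont (c d : R) : continuous (fun z : plane R => (c + z.1, d + z.2) : plane R).
  move=> [x y]; apply: cvg_pair2.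
    by apply: cvgD; [exact: cvg_cst|exact: (@cvg_fst _ _ (nbhs x) (nbhs y) _)].
  by apply: cvgD; [exact: cvg_cst|exact: (@cvg_snd _ _ (nbhs x) (nbhs y) _)].
have K1 : cancel tau sigma by move=> [x y]; rewrite /tau /sigma /= !addKr.
have K2 : cancel sigma tau by move=> [x y]; rewrite /tau /sigma /= !addNKr.
exists (translation A), (tau @` Omega), (fun w => (translation A (sigma w, u (sigma w))).2).
have G : translation A @` graph Omega u =
    graph (tau @` Omega) (fun w => (translation A (sigma w, u (sigma w))).2).
  by apply: graph_image => z Oz; rewrite K1.
split.
- exact: translation_isometry.
- exact: domain_image (cont _ _) (cont _ _) K1 K2 dO.
- exact: G.
- by right; exists a, b; rewrite -G => _ [_ [z Oz <-] <-]; exact: H.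
Qed.

Lemma affine_classified Omega u : domain Omega ->
  (exists a b c : R, forall z, Omega z -> u z = a * z.1 + b * z.2 + c) ->
  classified Omega u.
Proof.
move=> dO [a [b [c H]]].
(* The plane t = a x + b y + c has p = q = 0 exactly over (2 b, - 2 a), at height c. This
   translation moves that point to the origin. *)
apply: (@translation_classified _ _ (- 2 * b, 2 * a, - c)) => //.
exists 0, 0 => z Oz.
have -> : translation (- 2 * b, 2 * a, - c) (z, u z) = ((- 2 * b + z.1, 2 * a + z.2), 0).
  by apply: heis_eqP => //=; rewrite H//; field.
exact: helicoid_flat.
Qed.

(** The function vanishing at 0 whose complex gradient is c z + d, for c = c1 + i c2 and d = d1 + i
    d2. *)
Definition saddle (c1 c2 d1 d2 : R) z : R :=
  - (c2 / 2 * (z.1 ^+ 2 - z.2 ^+ 2) + c1 * z.1 * z.2 + d2 * z.1 + d1 * z.2) / 2.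

(** The unit circle without 1 has the rational parametrisation c1 = (m^2 - 1) / (m^2 + 1), c2 = 2 m
    / (m^2 + 1), inverted by m = c2 / (1 - c1), the stereographic projection from 1. The centre (x0,
    y0) is the critical point - d conj c of the saddle; there the linear part disappears, so a = 0
    suffices. *)
Lemma saddle_hyperbolic (c1 c2 d1 d2 b : R) : c1 ^+ 2 + c2 ^+ 2 = 1 -> c1 != 1 ->
  exists m a b' x0 y0 : R, forall z,
    saddle c1 c2 d1 d2 z + b = hyperbolic m a b' x0 y0 z.
Proof.
move=> cc c11.
have n1 : 1 - c1 != 0 by rewrite subr_eq0 eq_sym.
pose m := c2 / (1 - c1).
have m2 : 1 + m ^+ 2 = 2 / (1 - c1).
  rewrite /m expr_div_n (_ : c2 ^+ 2 = 1 - c1 ^+ 2); last by rewrite -cc addrC addKr.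
  by field.
have mp : 1 + m ^+ 2 != 0 by rewrite gt_eqF// ltr_wpDr ?sqr_ge0.
have e2 : m / (1 + m ^+ 2) = c2 / 2 by rewrite m2 /m; field.
have e1 : (m ^+ 2 - 1) / (m ^+ 2 + 1) = c1.
  rewrite (addrC _ 1) m2 (_ : m ^+ 2 - 1 = 2 / (1 - c1) - 2); last by rewrite -m2; ring.
  by field.
pose x0 := - c2 * d2 - c1 * d1; pose y0 := - c1 * d2 + c2 * d1.
exists m, 0, (b + (c2 / 2 * (x0 ^+ 2 - y0 ^+ 2) + c1 * x0 * y0) / 2), x0, y0 => z.
rewrite /hyperbolic e1 e2 !mul0r !addr0 /saddle /=.
have E2 : d2 = - (c2 * x0 + c1 * y0).
  by transitivity (d2 * (c1 ^+ 2 + c2 ^+ 2)); [rewrite cc mulr1|rewrite /x0 /y0; ring].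
have E1 : d1 = - (c1 * x0 - c2 * y0).
  by transitivity (d1 * (c1 ^+ 2 + c2 ^+ 2)); [rewrite cc mulr1|rewrite /x0 /y0; ring].
by clearbody x0 y0; rewrite E1 E2; field.
Qed.

Lemma saddle_classified Omega u (c1 c2 d1 d2 b : R) : domain Omega ->
  c1 ^+ 2 + c2 ^+ 2 = 1 -> (forall z, Omega z -> u z = saddle c1 c2 d1 d2 z + b) ->
  classified Omega u.
Proof.
move=> dO cc H; have [c11|c11] := eqVneq c1 1; last first.
  have [m [a [b' [x0 [y0 E]]]]] := saddle_hyperbolic d1 d2 b cc c11.
  exists id, Omega, u; split => //; first by split => //; exists id.
    by rewrite image_id.
  by left; exists m, a, b', x0, y0 => z Oz; rewrite H.
have c20 : c2 = 0.
  by move: cc; rewrite c11 expr1n => /eqP; rewrite eq_sym addrC -subr_eq subrr eq_sym sqrf_eq0 => /eqP.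
pose tau z : plane R := (- z.2, z.1); pose sigma z : plane R := (z.2, - z.1).
have K1 : cancel tau sigma by move=> [x y]; rewrite /tau /sigma /= opprK.
have K2 : cancel sigma tau by move=> [x y]; rewrite /tau /sigma /= opprK.
have ct : continuous tau.
  move=> [x y]; apply: cvg_pair2.
    by apply: cvgN; exact: (@cvg_snd _ _ (nbhs x) (nbhs y) _).
  exact: (@cvg_fst _ _ (nbhs x) (nbhs y) _).
have cs : continuous sigma.
  move=> [x y]; apply: cvg_pair2; first exact: (@cvg_snd _ _ (nbhs x) (nbhs y) _).
  by apply: cvgN; exact: (@cvg_fst _ _ (nbhs x) (nbhs y) _).
have cc' : (-1 : R) ^+ 2 + 0 ^+ 2 = 1 by ring.
have n : (-1 : R) != 1 by rewrite eq_sym -subr_eq0 opprK (_ : 1 + 1 = 2) ?pnatr_eq0.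
(* After the rotation z -> i z the saddle has c = -1, so a finite slope exists, and d becomes - i d
   = d2 - i d1. *)
have [m [a [b' [x0 [y0 E]]]]] := saddle_hyperbolic d2 (- d1) b cc' n.
exists (@quarter_turn R), (tau @` Omega), (u \o sigma); split.
- exact: quarter_turn_isometry.
- exact: domain_image ct cs K1 K2 dO.
- by apply: graph_image => z Oz /=; rewrite K1.
- left; exists m, a, b', x0, y0 => _ [z Oz <-]; rewrite -E /= K1 H// /saddle c11 c20 /=.
  by congr (_ + _); ring.
Qed.

End Models.

(** * Helicoids around a pole of the complex gradient *)

Section HelicoidCase.
Variable R : realType.
Implicit Types (Omega : set (plane R)) (u : plane R -> R) (z w v : plane R).
Local Notation ex := (@e_x R).
Local Notation ey := (@e_y R).
Local Notation C := R[i].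

(* If th turns like the polar angle of (X, Y), then rotating the unit vector
   (X, Y) / |(X, Y)| by the angle - th gives a constant vector. *)
Lemma derive_rotated_unit (X Y th : plane R -> R) z v (dx dy : R) :
  let r2 := X z ^+ 2 + Y z ^+ 2 in
  let ir w := (Num.sqrt (X w ^+ 2 + Y w ^+ 2))^-1 in
  r2 != 0 -> is_derive z v X dx -> is_derive z v Y dy ->
  is_derive z v th ((X z * dy - Y z * dx) / r2) ->
  is_derive z v (fun w => (X w * cos (th w) + Y w * sin (th w)) * ir w) 0 /\
  is_derive z v (fun w => (Y w * cos (th w) - X w * sin (th w)) * ir w) 0.
Proof.
move=> r2 ir r0 DX DY Dth.
have r2p : 0 < r2 by rewrite lt_neqAle eq_sym r0 addr_ge0// sqr_ge0.
have Dc := is_derive_comp_real (is_derive_cos (th z)) Dth.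
have Ds := is_derive_comp_real (is_derive_sin (th z)) Dth.
pose rho := Num.sqrt r2.
have rho0 : 0 < rho by rewrite sqrtr_gt0.
have rr : rho ^+ 2 = r2 by rewrite sqr_sqrtr// ltW.
have Dr2 : is_derive z v (fun w => X w ^+ 2 + Y w ^+ 2) (2 * (X z * dx + Y z * dy)).
  apply: is_derive_eq (is_deriveD (is_deriveM DX DX) (is_deriveM DY DY)) _.
  by rewrite /GRing.scale /=; ring.
have Drho : is_derive z v (fun w => Num.sqrt (X w ^+ 2 + Y w ^+ 2))
    ((X z * dx + Y z * dy) / rho).
  have D : is_derive r2 (1 : R) Num.sqrt (2 * rho)^-1 by exact: is_derive1_sqrt.
  apply: is_derive_eq (is_derive_comp_real D Dr2) _.
  by field; exact: lt0r_neq0.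
have Dir : is_derive z v ir (- (X z * dx + Y z * dy) / rho ^+ 3).
  apply: is_derive_eq (is_derive_inv (lt0r_neq0 rho0) Drho) _.
  by rewrite -/rho; field; exact: lt0r_neq0.
have rn := lt0r_neq0 rho0.
split.
  apply: is_derive_eq (is_deriveM (is_deriveD (is_deriveM DX Dc) (is_deriveM DY Ds)) Dir) _.
  rewrite !fctE /GRing.scale /= /ir -/r2 -/rho -rr.
  transitivity ((rho ^+ 2 - r2) * (dx * cos (th z) + dy * sin (th z)) / rho ^+ 3).
    by rewrite /r2; field.
  by rewrite rr subrr !mul0r.
apply: is_derive_eq (is_deriveM (is_deriveB (is_deriveM DY Dc) (is_deriveM DX Ds)) Dir) _.
rewrite !fctE /GRing.scale /= /ir -/r2 -/rho -rr.
transitivity ((rho ^+ 2 - r2) * (dy * cos (th z) - dx * sin (th z)) / rho ^+ 3).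
  by rewrite /r2; field.
by rewrite rr subrr !mul0r.
Qed.

(** Translation by (- s1, - s2, 0) turns the height into a [th], and the hypothesis on the gradient
    says that [th] turns like the polar angle about (s1, s2). The radial unit vector rotated back by
    [th] is then a constant (cos beta, sin beta), so [th] + beta is a polar angle on all of
    Omega. *)
Lemma helicoid_classified Omega u (a s1 s2 : R) : domain Omega -> a != 0 ->
  let r2 z := (z.1 - s1) ^+ 2 + (z.2 - s2) ^+ 2 in
  (forall z, Omega z -> r2 z != 0) ->
  (forall z, Omega z -> is_derive z ex u (- s2 / 2 - a * (z.2 - s2) / r2 z) /\
                        is_derive z ey u (s1 / 2 + a * (z.1 - s1) / r2 z)) ->
  classified Omega u.
Proof.
move=> dO a0 r2 r0 Du.
pose X (w : plane R) := w.1 - s1; pose Y (w : plane R) := w.2 - s2.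
pose th w := (u w + (s2 * w.1 - s1 * w.2) / 2) / a.
pose ir w := (Num.sqrt (X w ^+ 2 + Y w ^+ 2))^-1.
pose W1 w := (X w * cos (th w) + Y w * sin (th w)) * ir w.
pose W2 w := (Y w * cos (th w) - X w * sin (th w)) * ir w.
have DX z : is_derive z ex X 1 /\ is_derive z ey X 0.
  by split; apply: is_derive_affine => h; rewrite /X ?scale_ex ?scale_ey /=; ring.
have DY z : is_derive z ex Y 0 /\ is_derive z ey Y 1.
  by split; apply: is_derive_affine => h; rewrite /Y ?scale_ex ?scale_ey /=; ring.
have DA z : is_derive z ex (fun w => (s2 * w.1 - s1 * w.2) / 2) (s2 / 2) /\
    is_derive z ey (fun w => (s2 * w.1 - s1 * w.2) / 2) (- (s1 / 2)).
  by split; apply: is_derive_affine => h; rewrite ?scale_ex ?scale_ey /=; ring.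
have thE : th = a^-1 \*: (u + (fun w => (s2 * w.1 - s1 * w.2) / 2)).
  by apply/funext => w; rewrite /th mulrC.
have Dth z : Omega z -> is_derive z ex th ((X z * 0 - Y z * 1) / (X z ^+ 2 + Y z ^+ 2)) /\
    is_derive z ey th ((X z * 1 - Y z * 0) / (X z ^+ 2 + Y z ^+ 2)).
  move=> Oz; have [ux uy] := Du z Oz; have [Ax Ay] := DA z.
  rewrite thE; split.
    apply: is_derive_eq (is_deriveZ a^-1 (is_deriveD ux Ax)) _.
    by have := r0 z Oz; rewrite /GRing.scale /= /X /Y /r2 => rz; field; rewrite a0 rz.
  apply: is_derive_eq (is_deriveZ a^-1 (is_deriveD uy Ay)) _.
  by have := r0 z Oz; rewrite /GRing.scale /= /X /Y /r2 => rz; field; rewrite a0 rz.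
have Wx z (Oz : Omega z) := derive_rotated_unit (r0 z Oz) (DX z).1 (DY z).1 (Dth z Oz).1.
have Wy z (Oz : Omega z) := derive_rotated_unit (r0 z Oz) (DX z).2 (DY z).2 (Dth z Oz).2.
have [C1 H1] : exists C1, forall z, Omega z -> W1 z = C1.
  apply: domain_constant dO _ => z Oz.
  have [[dx ex_] _] := Wx z Oz; have [[dy ey_] _] := Wy z Oz.
  by split; [exact: dx|exact: dy|exact: ex_|exact: ey_].
have [C2 H2] : exists C2, forall z, Omega z -> W2 z = C2.
  apply: domain_constant dO _ => z Oz.
  have [_ [dx ex_]] := Wx z Oz; have [_ [dy ey_]] := Wy z Oz.
  by split; [exact: dx|exact: dy|exact: ex_|exact: ey_].
have [_ _ [z0 Oz0]] := dO.
have rho z : Omega z -> 0 < Num.sqrt (r2 z) /\ Num.sqrt (r2 z) ^+ 2 = X z ^+ 2 + Y z ^+ 2.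
  move=> Oz; have p : 0 <= r2 z by rewrite addr_ge0// sqr_ge0.
  by rewrite sqrtr_gt0 lt_neqAle eq_sym (r0 z Oz) p sqr_sqrtr.
have rot z : Omega z ->
  X z = Num.sqrt (r2 z) * (C1 * cos (th z) - C2 * sin (th z)) /\
  Y z = Num.sqrt (r2 z) * (C1 * sin (th z) + C2 * cos (th z)).
  move=> Oz; rewrite -(H1 z Oz) -(H2 z Oz) /W1 /W2.
  have -> : ir z = (Num.sqrt (r2 z))^-1 by [].
  have [rp _] := rho z Oz; have rn := lt0r_neq0 rp.
  have cs := cos2Dsin2 (th z).
  split; apply/esym.
    transitivity (X z * (cos (th z) ^+ 2 + sin (th z) ^+ 2)); last by rewrite cs mulr1.
    by field.
  transitivity (Y z * (cos (th z) ^+ 2 + sin (th z) ^+ 2)); last by rewrite cs mulr1.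
  by field.
have CC : C1 ^+ 2 + C2 ^+ 2 = 1.
  have [rp re] := rho z0 Oz0; have rn := lt0r_neq0 rp.
  have [e1 e2] := rot z0 Oz0.
  have := re; rewrite e1 e2 => E.
  have cs := cos2Dsin2 (th z0).
  apply: (mulfI (expf_neq0 2 rn)); rewrite mulr1 {2}E.
  transitivity (Num.sqrt (r2 z0) ^+ 2 * (C1 ^+ 2 + C2 ^+ 2) *
     (cos (th z0) ^+ 2 + sin (th z0) ^+ 2)); first by rewrite cs mulr1.
  ring.
have [beta [cb sb]] := unit_angle CC.
apply: (@translation_classified _ _ _ (- s1, - s2, 0)) => //.
(* The vertical shift - a beta compensates the constant phase beta of the angle. *)
exists a, (- a * beta) => z Oz.
exists (Num.sqrt (r2 z)), (th z + beta); split; first exact: sqrtr_ge0.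
have [e1 e2] := rot z Oz.
rewrite cosD sinD cb sb; apply: heis_eqP; rewrite /translation /=.
- by transitivity (X z); [rewrite /X addrC|rewrite e1; ring].
- by transitivity (Y z); [rewrite /Y addrC|rewrite e2; ring].
- by rewrite /th; field.
Qed.

End HelicoidCase.

(** * From the complex gradient to the model surfaces *)

Section Persistent.
Variable R : realType.
Implicit Types (Omega : set (plane R)) (u : plane R -> R) (z w v : plane R).
Local Notation ex := (@e_x R).
Local Notation ey := (@e_y R).
Local Notation C := R[i].

(* -2i (u_x - i u_y); the horizontal normal p + i q of the graph is
   (i / 2) (z + conj (complex_gradient u z)). *)
Definition complex_gradient u z : C := ((- 2 * 'D_ey u z) +i* (- 2 * 'D_ex u z))%C.

Section Gradient.
Variables (Omega : set (plane R)) (u : plane R -> R).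
Hypotheses (oO : open Omega) (hu : persistent Omega u).

Let uC : Ck 2 Omega u. Proof. by case: hu. Qed.

Let DM (f : plane R -> R) z v : derivable f z v -> 'D_v (fun w => - 2 * f w) z = - 2 * 'D_v f z.
Proof. by move=> df; exact: (deriveZ (- 2) df). Qed.

Let dux : forall z, Omega z -> derivable ('D_ex u) z ex /\ derivable ('D_ex u) z ey.
Proof. by move=> z; case/Ck2P: uC => _ /Ck1P H _ /H[dx dy _ _ _]; split; [exact: dx|exact: dy]. Qed.
Let duy : forall z, Omega z -> derivable ('D_ey u) z ex /\ derivable ('D_ey u) z ey.
Proof. by move=> z; case/Ck2P: uC => _ _ /Ck1P H /H[dx dy _ _ _]; split; [exact: dx|exact: dy]. Qed.

(** The Cauchy-Riemann equations are here Lap u = 0 and the symmetry of the mixed derivatives. *)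
Lemma persistent_holomorphic : holomorphic Omega (complex_gradient u).
Proof.
have [u1 ux uy] := (Ck2P _ _).1 uC.
split; [exact: Ck1Z oO uy|exact: Ck1Z oO ux|] => z Oz /=.
have [dxx dxy] := dux Oz; have [dyx dyy] := duy Oz.
rewrite (DM dyx) (DM dyy) (DM dxx) (DM dxy).
have [lap _] := persistent_eqs hu Oz.
split; first by rewrite (Ck2_symmetric oO uC Oz).
have -> : 'D_ey ('D_ey u) z = - 'D_ex ('D_ex u) z by exact/esym/addr0_eq.
by rewrite mulrN.
Qed.

Lemma persistent_ruled z : Omega z ->
  (cplane z + conjc (complex_gradient u z)) ^+ 2 * dz (complex_gradient u) z =
  (conjc (cplane z) + complex_gradient u z) ^+ 2 * conjc (dz (complex_gradient u) z).
Proof.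
move=> Oz.
have [dxx dxy] := dux Oz; have [dyx dyy] := duy Oz.
have [lap E] := persistent_eqs hu Oz.
have yyE : 'D_ey ('D_ey u) z = - 'D_ex ('D_ex u) z by exact/esym/addr0_eq.
rewrite yyE in E.
rewrite /dz /complex_gradient /= (DM dyx) (DM dxx) /cplane.
move: E; rewrite /p /q.
move: ('D_ex ('D_ex u) z) ('D_ex ('D_ey u) z) ('D_ex u z) ('D_ey u z) => a b c d.
case: z {Oz dxx dxy dyx dyy lap yyE} => x y /= E.
rewrite !expr2; apply: complex_eqP => /=; first by ring.
(* Here z + conj phi = - 2 i (p + i q) and phi' = - 2 u_xy - 2 i u_xx, so the left side has
   imaginary part - 8 times the expression in [E]. The right side is its conjugate, which doubles
   the factor to - 16. *)
by apply: subr0_eq; rewrite -[RHS](mulr0 (- 16)) -E; field.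
Qed.

Lemma persistent_gradient z : Omega z ->
  is_derive z ex u (- (complex.Im (complex_gradient u z)) / 2) /\
  is_derive z ey u (- (complex.Re (complex_gradient u z)) / 2).
Proof.
move=> Oz; have [/Ck1P u1 _ _] := (Ck2P _ _).1 uC.
have [dx dy _ _ _] := u1 z Oz.
rewrite /complex_gradient /=; split.
  by apply: is_derive_eq (derivableP dx) _; field.
by apply: is_derive_eq (derivableP dy) _; field.
Qed.

End Gradient.

Lemma persistent_classified Omega u : domain Omega -> persistent Omega u ->
  classified Omega u.
Proof.
move=> dO hu; have [oO cO O0] := dO.
have G := persistent_gradient hu.
have [[d H]|[c [d [cc H]]]|[k [s [k0 H]]]] := phi_classification oO cO
  (persistent_holomorphic oO hu) (@persistent_ruled Omega u hu) O0.
- apply: affine_classified => //.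
  pose a := - complex.Im d / 2; pose b := - complex.Re d / 2.
  have [c Hc] : exists c, forall z, Omega z -> u z = a * z.1 + b * z.2 + c.
    apply: (@gradient_constant _ _ _ (fun z => a * z.1 + b * z.2) (fun=> a) (fun=> b)) => //.
      by move=> z Oz; have := G z Oz; rewrite H.
    move=> z Oz; split; apply: is_derive_affine => h; rewrite ?scale_ex ?scale_ey /=; ring.
  by exists a, b, c.
- case: c d cc H => c1 c2 [d1 d2] cc H.
  have cc' : c1 ^+ 2 + c2 ^+ 2 = 1.
    by case: cc => <- _; ring.
  have [b Hb] : exists b, forall z, Omega z -> u z = saddle c1 c2 d1 d2 z + b.
    apply: (@gradient_constant _ _ _ _ (fun z => - (c1 * z.2 + c2 * z.1 + d2) / 2)
      (fun z => - (c1 * z.1 - c2 * z.2 + d1) / 2)) => //.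
      by move=> z Oz; have := G z Oz; rewrite H.
    move=> z Oz; have [Xx Xy] := derive_fst z; have [Yx Yy] := derive_snd z.
    pose X (w : plane R) := w.1; pose Y (w : plane R) := w.2.
    have sE : saddle c1 c2 d1 d2 = (- (c2 / 4)) \*: (X * X - Y * Y) +
      (- (c1 / 2)) \*: (X * Y) + (- (d2 / 2)) \*: X + (- (d1 / 2)) \*: Y.
      by apply/funext => w; rewrite /saddle !fctE /= /GRing.scale /= /X /Y; field.
    rewrite sE; split.
      apply: is_derive_eq (is_deriveD (is_deriveD (is_deriveD (is_deriveZ _
        (is_deriveB (is_deriveM Xx Xx) (is_deriveM Yx Yx)))
        (is_deriveZ _ (is_deriveM Xx Yx))) (is_deriveZ _ Xx)) (is_deriveZ _ Yx)) _.
      by rewrite /GRing.scale /=; field.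
    apply: is_derive_eq (is_deriveD (is_deriveD (is_deriveD (is_deriveZ _
      (is_deriveB (is_deriveM Xy Xy) (is_deriveM Yy Yy)))
      (is_deriveZ _ (is_deriveM Xy Yy))) (is_deriveZ _ Xy)) (is_deriveZ _ Yy)) _.
    by rewrite /GRing.scale /=; field.
  exact: saddle_classified dO cc' Hb.
- case: s H => s1 s2 H.
  have rn z : Omega z -> (z.1 - s1) ^+ 2 + (z.2 - s2) ^+ 2 != 0.
    move=> /H[zs _]; apply/negP.
    rewrite paddr_eq0 ?sqr_ge0// !sqrf_eq0 !subr_eq0 => /andP[/eqP z1 /eqP z2].
    by move/eqP: zs; apply; rewrite /cplane z1 z2.
  (* The factor - 1 / 2 between phi and the derivatives of u turns the residue - k into the helicoid
     constant k / 2. *)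
  have a0 : k / 2 != 0 by rewrite mulf_neq0// invr_eq0 pnatr_eq0.
  apply: (@helicoid_classified _ _ _ (k / 2) s1 s2 dO a0 rn) => z Oz.
  have := G z Oz; have [_ ->] := H z Oz; have := rn z Oz.
  rewrite invcE /=.
  move: (z.1) (z.2) => x y r0.
  by move=> [ux uy]; split; [apply: is_derive_eq ux _|apply: is_derive_eq uy _]; field.
Qed.

End Persistent.

Theorem theorem4 (R : realType) (Omega : set (plane R)) (u : plane R -> R)
    (hOmega : domain Omega) (hu : persistent Omega u) :
  exists (phi : heis R -> heis R) (Omega' : set (plane R)) (u' : plane R -> R),
    [/\ dcc_isometry phi, domain Omega',
        phi @` graph Omega u = graph Omega' u' &
        (exists m a b x0 y0 : R,
            forall z, Omega' z -> u' z = hyperbolic m a b x0 y0 z)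
        \/ (exists a b : R, graph Omega' u' `<=` helicoid a b)].
Proof. exact: persistent_classified. Qed.
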